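(* In the setting and notation of the context, let $T\in(0,T_0)$. Then the solution operator $$W_1: C([0,T];B_{H^2}(\tilde u_0,r))\to Z(T),\qquad \tilde u\mapsto W_1(\tilde u)=(\tilde v,\tilde w)=(\tilde v(\tilde u),\tilde w(\tilde u)),$$ where $$[W_1(\tilde u)](t)=T(t)\begin{pmatrix}\tilde v_0\\\tilde w_0\end{pmatrix}+\int_0^tT(t-s)\begin{pmatrix}[G(\tilde w)](s)+\beta_p\tilde u(s)\\0\end{pmatrix}ds,\quad t\in[0,T],$$ is Lipschitz continuous: for all $\tilde u_1,\tilde u_2\in C([0,T];B_{H^2}(\tilde u_0,r))$, $$\sup_{t\in[0,T]}\|[W_1(\tilde u_1)](t)-[W_1(\tilde u_2)](t)\|_{L^2(\Omega)\times H^1(\Omega)}\le L_W\sup_{t\in[0,T]}\|\tilde u_1(t)-\tilde u_2(t)\|_{H^2(\Omega)},$$ where $L_W$ is a constant depending on $T_0$, $M_0$, $\kappa$, $\|w_0\|_{H^1(\Omega)}$, $\Omega$, $\beta_p$ and $\beta_F$. Furthermore, the map $$W_2:C([0,T];B_{H^2}(\tilde u_0,r))\to C([0,T];L^2(\Omega)),\qquad \tilde u\mapsto\frac{\tilde v}{\tilde w+\theta_2},\quad (\tilde v,\tilde w)=W_1(\tilde u),$$ is also Lipschitz continuous: for all $\tilde u_1,\tilde u_2\in C([0,T];B_{H^2}(\tilde u_0,r))$, $$\sup_{t\in[0,T]}\|[W_2(\tilde u_1)](t)-[W_2(\tilde u_2)](t)\|_{L^2(\Omega)}\le L_{W_2}\sup_{t\in[0,T]}\|\tilde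 u_1(t)-\tilde u_2(t)\|_{H^2(\Omega)},$$ where $L_{W_2}$ is a constant depending on $L_W$ and $\|\tilde v_0\|_{L^2(\Omega)}$ (and on the quantities on which $L_W$ depends).
   Context: $\Omega\subset\mathbb R$ is an open bounded interval; $\beta_F,\beta_p,\theta_1,\theta_2>0$ are constants; $\sigma\in(0,\frac12)$; $u_0\in H^{2+\sigma}(\Omega)$, $v_0\in H^1_0(\Omega)$, $w_0\in H^2(\Omega)$ with $u_0=\theta_1$, $w_0=\theta_2$ on $\partial\Omega$ and $\kappa:=\inf_\Omega w_0>0$. Put $\tilde u_0=u_0-\theta_1$, $\tilde v_0=v_0$, $\tilde w_0=w_0-\theta_2$. $C=C(\Omega)>0$ is a constant with $\|f\|_{L^\infty(\Omega)}\le C\|f\|_{H^1(\Omega)}$ for all $f\in H^1(\Omega)$, and $r\in(0,\frac{\kappa}{2C})$ is fixed. $B_{H^2}(U,r)=\{f\in H^2(\Omega): f|_{\partial\Omega}=U|_{\partial\Omega},\ \|f-U\|_{H^2(\Omega)}\le r\}$, and $C([0,T];B_{H^2}(U,r))$ is the set of $u\in C([0,T];H^2(\Omega))$ with $u(t)\in B_{H^2}(U,r)$ for all $t$. $\Delta_D$ is the Dirichlet Laplacian with domain $H^2(\Omega)\cap H^1_0(\Omega)$; $\{T(t)\}_{t\ge0}$ is the $C_0$-semigroup on $L^2(\Omega)\times H^1_0(\Omega)$ generated by $\mathcal A=\begin{pmatrix}0&\Delta_D\\1&0\end{pmatrix}$, $D(\mathcal A)=H^1_0(\Omega)\times(H^2(\Omega)\cap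 H^1_0(\Omega))$; $M_0=\sup_{t\ge0}\|T(t)\|_{\mathcal B(L^2(\Omega)\times H^1_0(\Omega))}$. $[G(\tilde w)](t)=-\beta_F(\tilde w(t)+\theta_2)^{-2}+\beta_p(\theta_1-1)$. $Z(T)$ is the set of $(\tilde v,\tilde w)\in C([0,T];L^2(\Omega)\times H^1_0(\Omega))$ with $(\tilde v(0),\tilde w(0))=(\tilde v_0,\tilde w_0)$ and $\sup_{t\in[0,T]}\|(\tilde v(t)-\tilde v_0,\tilde w(t)-\tilde w_0)\|_{L^2(\Omega)\times H^1(\Omega)}\le r$. $T_0>0$ is a fixed number such that for every $T\in(0,T_0)$ and every $\tilde u\in C([0,T];B_{H^2}(\tilde u_0,r))$ there is a unique $(\tilde v,\tilde w)\in Z(T)$ satisfying $(\tilde v,\tilde w)(t)=T(t)(\tilde v_0,\tilde w_0)+\int_0^tT(t-s)([G(\tilde w)](s)+\beta_p\tilde u(s),0)\,ds$ for $t\in[0,T]$ (such $T_0$ exists); $W_1(\tilde u)$ denotes this $(\tilde v,\tilde w)$. *)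

(* Defs.v *)
From HB Require Import structures.
From mathcomp Require Import all_boot all_order all_algebra.
From mathcomp Require Import all_classical all_reals all_analysis.

Set Implicit Arguments.
Unset Strict Implicit.
Unset Printing Implicit Defensive.
Import Order.TTheory GRing.Theory Num.Theory.
Import numFieldNormedType.Exports.
Local Open Scope classical_set_scope.
Local Open Scope ring_scope.

(*  An element of a function space over ]a, b[ is represented by a function
    R -> R whose values outside ]a, b[ are irrelevant, and two functions that
    agree almost everywhere on ]a, b[ represent the same element.  Norms are
    therefore seminorms on representatives, and the equality x = y of two
    elements of a space with norm N reads N (x - y) = 0. *)

Definition leb_itv {R : realType} (a b : R) :
    {measure set (measurableTypeR R) -> \bar R} :=
  mrestr lebesgue_measure (measurable_itv `]a, b[).

Definition L2 {R : realType} (a b : R) : set (R -> R) :=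
  [set f | f \in Lfun (leb_itv a b) 2%:E].

(* Only meaningful on [L2 a b]: [fine] sends an infinite norm to 0. *)
Definition L2norm {R : realType} (a b : R) (f : R -> R) : R :=
  fine ('N[leb_itv a b]_2%:E [EFin \o f])%E.

(* C_c^oo(]a, b[), as functions on R extended by 0. *)
Definition test_function {R : realType} (a b : R) : set (R -> R) :=
  [set phi | (forall n x, derivable (phi^`(n))%classic x 1) /\
     exists K : set R, [/\ compact K, K `<=` `]a, b[%classic &
       forall x, ~ K x -> phi x = 0]].

Definition weak_derivative {R : realType} (a b : R) (f g : R -> R) : Prop :=
  forall phi, test_function a b phi ->
    Rintegral (leb_itv a b) setT (fun x => f x * (phi^`())%classic x) =
    - Rintegral (leb_itv a b) setT (fun x => g x * phi x).

Definition H1 {R : realType} (a b : R) : set (R -> R) :=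
  [set f | L2 a b f /\ exists2 g, L2 a b g & weak_derivative a b f g].

(* Unique up to a.e. equality for [f] in [H1]; the default value 0 is used
   only outside [H1]. *)
Definition wD {R : realType} (a b : R) (f : R -> R) : R -> R :=
  xget 0 [set g | L2 a b g /\ weak_derivative a b f g].

Definition H1norm {R : realType} (a b : R) (f : R -> R) : R :=
  Num.sqrt (L2norm a b f ^+ 2 + L2norm a b (wD a b f) ^+ 2).

Definition H2 {R : realType} (a b : R) : set (R -> R) :=
  [set f | H1 a b f /\ H1 a b (wD a b f)].

Definition H2norm {R : realType} (a b : R) (f : R -> R) : R :=
  Num.sqrt (L2norm a b f ^+ 2 + L2norm a b (wD a b f) ^+ 2 +
            L2norm a b (wD a b (wD a b f)) ^+ 2).

(* H^{2+sigma}, 0 < sigma < 1, by the Sobolev-Slobodeckij (Gagliardo)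
   seminorm of the second derivative. *)
Definition H2plus {R : realType} (a b sigma : R) : set (R -> R) :=
  [set f | H2 a b f /\
    (\int[leb_itv a b]_x \int[leb_itv a b]_y
       ((wD a b (wD a b f) x - wD a b (wD a b f) y) ^+ 2 /
        `|x - y| `^ (1 + 2 * sigma))%:E < +oo)%E].

(* H^1_0: the closure of C_c^oo in H^1. *)
Definition H10 {R : realType} (a b : R) : set (R -> R) :=
  [set f | H1 a b f /\ forall e, 0 < e ->
    exists2 phi, test_function a b phi & H1norm a b (f - phi) < e].

(* [g] is a representative of [f] that is continuous up to the boundary. *)
Definition continuous_representative {R : realType} (a b : R) (f g : R -> R)
    : Prop :=
  {within `[a, b], continuous g} /\ f = g %[ae (leb_itv a b)].

(* f = g on the boundary {a, b}, in the sense of traces: elements of H^1 have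
   representatives continuous on [a, b]. *)
Definition boundary_eq {R : realType} (a b : R) (f g : R -> R) : Prop :=
  exists fc gc, [/\ continuous_representative a b f fc,
    continuous_representative a b g gc, fc a = gc a & fc b = gc b].

Definition H2ball {R : realType} (a b : R) (U : R -> R) (r : R) : set (R -> R) :=
  [set f | [/\ H2 a b f, boundary_eq a b f U & H2norm a b (f - U) <= r]].

(*  Below, (D, N) stands for the normed space obtained from the linear subspace
    [D] of [V] and the seminorm [N] on it by identifying x and y when
    N (x - y) = 0. *)

(* C([0, T]; D); the values of [u] outside [0, T] are irrelevant. *)
Definition C0T {R : realType} {V : lmodType R} (D : set V) (N : V -> R) (T : R)
    : set (R -> V) :=
  [set u | (forall t, 0 <= t <= T -> D (u t)) /\
    forall t, 0 <= t <= T ->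
      N (u s - u t) @[s --> within `[0, T] (nbhs t)] --> (0 : R)].

Definition sup_norm {R : realType} {V : lmodType R} (N : V -> R) (T : R)
    (u : R -> V) : \bar R :=
  ereal_sup [set (N (u t))%:E | t in `[0, T]].

(* [y] is the integral of F over [0, t], as the limit of the Riemann sums over
   tagged partitions p 0 <= p 1 <= ... <= p n with tags [xi].  For continuous
   [F] this is the Bochner integral. *)
Definition is_integral {R : realType} {V : lmodType R} (D : set V) (N : V -> R)
    (F : R -> V) (t : R) (y : V) : Prop :=
  D y /\ forall e, 0 < e -> exists2 delta, 0 < delta &
    forall (n : nat) (p xi : nat -> R), p 0%N = 0 -> p n = t ->
      (forall i, (i < n)%N ->
         p i <= xi i <= p i.+1 /\ p i.+1 - p i < delta) ->
      N (\sum_(i < n) (p i.+1 - p i) *: F (xi i) - y) < e.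

Record C0_semigroup {R : realType} {V : lmodType R} (D : set V) (N : V -> R)
    (S : R -> V -> V) : Prop := {
  semigroup_stable : forall t x, 0 <= t -> D x -> D (S t x);
  semigroup_linear : forall t k x y, 0 <= t -> D x -> D y ->
    N (S t (k *: x + y) - (k *: S t x + S t y)) = 0;
  semigroup_bounded : forall t, 0 <= t ->
    exists M, forall x, D x -> N (S t x) <= M * N x;
  semigroup0 : forall x, D x -> N (S 0 x - x) = 0;
  semigroupD : forall s t x, 0 <= s -> 0 <= t -> D x ->
    N (S (s + t) x - S s (S t x)) = 0;
  semigroup_continuous : forall x, D x ->
    N (S h x - x) @[h --> 0^'+] --> (0 : R) }.

(* The operator with graph [A] is the infinitesimal generator of [S]. *)
Definition is_generator {R : realType} {V : lmodType R} (D : set V) (N : V -> R)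
    (S : R -> V -> V) (A : V -> V -> Prop) : Prop :=
  forall x y, D x -> D y ->
    A x y <-> N (h^-1 *: (S h x - x) - y) @[h --> 0^'+] --> (0 : R).

Definition opnorm {R : realType} {V : lmodType R} (D : set V) (N : V -> R)
    (L : V -> V) : \bar R :=
  ereal_sup [set (N (L x))%:E | x in [set x | D x /\ N x <= 1]].

Definition phase {R : realType} (a b : R) : set ((R -> R) * (R -> R)) :=
  [set z | L2 a b z.1 /\ H10 a b z.2].

Definition phase_norm {R : realType} (a b : R) (z : (R -> R) * (R -> R)) : R :=
  Num.sqrt (L2norm a b z.1 ^+ 2 + H1norm a b z.2 ^+ 2).

(* The graph of (v, w) |-> (Laplacian_D w, v) with domain
   H^1_0 x (H^2 cap H^1_0). *)
Definition wave_operator {R : realType} (a b : R)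
    (z z' : (R -> R) * (R -> R)) : Prop :=
  [/\ H10 a b z.1, H2 a b z.2, H10 a b z.2,
      z'.1 = wD a b (wD a b z.2) %[ae (leb_itv a b)] &
      z'.2 = z.1 %[ae (leb_itv a b)]].

Definition Gop {R : realType} (bF bp th1 th2 : R) (w : R -> R -> R) (t : R)
    : R -> R :=
  fun x => - bF * (w t x + th2) ^- 2 + bp * (th1 - 1).

Definition Zspace {R : realType} (a b r : R) (z0 : (R -> R) * (R -> R)) (T : R)
    : set (R -> (R -> R) * (R -> R)) :=
  [set z | [/\ C0T (phase a b) (phase_norm a b) T z,
     phase_norm a b (z 0 - z0) = 0 &
     (sup_norm (phase_norm a b) T (fun t => (z t - z0)%R) <= r%:E)%E]].

Definition mild_solution {R : realType} (a b bF bp th1 th2 : R)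
    (S : R -> (R -> R) * (R -> R) -> (R -> R) * (R -> R))
    (z0 : (R -> R) * (R -> R)) (T : R) (u : R -> R -> R)
    (z : R -> (R -> R) * (R -> R)) : Prop :=
  forall t, 0 <= t <= T -> exists y,
    is_integral (phase a b) (phase_norm a b)
      (fun s => S (t - s)
        (Gop bF bp th1 th2 (fun s' => (z s').2) s + bp *: u s, 0)) t y /\
    phase_norm a b (z t - (S t z0 + y)) = 0.

(* The solution is unique up to N (z t - z' t) = 0 for t in [0, T]; [xget]
   selects a representative. *)
Definition W1 {R : realType} (a b bF bp th1 th2 r : R)
    (S : R -> (R -> R) * (R -> R) -> (R -> R) * (R -> R))
    (z0 : (R -> R) * (R -> R)) (T : R) (u : R -> R -> R)
    : R -> (R -> R) * (R -> R) :=
  xget (fun=> 0) [set z | Zspace a b r z0 T z /\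
                          mild_solution a b bF bp th1 th2 S z0 T u z].

Definition W2 {R : realType} (a b bF bp th1 th2 r : R)
    (S : R -> (R -> R) * (R -> R) -> (R -> R) * (R -> R))
    (z0 : (R -> R) * (R -> R)) (T : R) (u : R -> R -> R) : R -> R -> R :=
  fun t x => let z := W1 a b bF bp th1 th2 r S z0 T u in
    (z t).1 x / ((z t).2 x + th2).

(* Main.v *)
Require Import Defs.
From HB Require Import structures.
From mathcomp Require Import all_boot all_order all_algebra.
From mathcomp Require Import all_classical all_reals all_analysis.
From mathcomp Require Import measurable_realfun ess_sup_inf.
From mathcomp Require Import ring lra.

Set Implicit Arguments.
Unset Strict Implicit.
Unset Printing Implicit Defensive.
Import Order.TTheory GRing.Theory Num.Theory.
Import numFieldNormedType.Exports.
Local Open Scope classical_set_scope.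
Local Open Scope ring_scope.

(** Why the theorem holds.  Subtract the variation of constants formulas of two
    solutions z = (v, w) and z' = (v', w') with data u and u': the terms
    S(t) z0 cancel, and there remains the integral of
    S(t - s) (G(w) - G(w') + bp (u - u'), 0) over [0, t].  The Sobolev
    embedding and the smallness of r keep w + th2 and w' + th2 above kappa / 2
    almost everywhere ([H1_lower_bound]), a region in which 1 / x^2 is
    Lipschitz with constant 16 / kappa^3.  Hence the norm of the integrand is
    at most M0 (bF (16 / kappa^3) |z - z'|(s) + bp |u - u'|(s)), and Gronwall's
    inequality yields the Lipschitz bound for W1.  For W2 write
    v / W - v' / W' = (v - v') / W + v' (1 / W - 1 / W') with W = w + th2,
    W' = w' + th2, use 1 / W <= 2 / kappa for the first term, and for the second
    one the Lipschitz continuity of the inverse, the embedding applied to w - w',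
    and |v'| <= |v0| + r ([quotient_lipschitz]).

    Integrals of phase-space-valued functions are limits of Riemann sums, so the
    comparison is made on the sums themselves: a Riemann sum of the norms with
    tags at the left end points is dominated by a telescoping sum of a
    supersolution ([is_integral_sub_le]).  Gronwall's inequality
    is then applied in the norm weighted by exp(- lam t), in which the
    integral operator is a contraction ([weighted_gronwall]).

    The constant of W2 may depend on the interval but not on the embedding
    constant C of the hypotheses.  The formula therefore uses an embedding
    constant chosen from a and b alone, while r is removed by applying
    the given embedding to w0: kappa <= C |w0|_H1, so r < |w0|_H1
    ([le_sobolev_H1norm]).

    All this needs the H^1 norm to be a seminorm, although it is defined through
    a chosen weak derivative.  That the choice is additive up to
    null sets is the fundamental lemma of the calculus of variations ([L2_ae0]),
    proved with smooth bumps converging to the indicator of ]a, y[ and Lebesgue's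
    differentiation theorem. *)

(** * Square-integrable functions on an interval *)

(* Measurability for the sigma-algebra on which [leb_itv] is defined, rather than
   for the default one of [R]. *)
Local Notation bfun f := (@measurable_fun _ _ (measurableTypeR _) _ setT f).

#[local] Instance leb_itv_ae_filter {R : realType} (a b : R) :
  Filter (nbhs (almost_everywhere (leb_itv a b))).
Proof. exact: ae_filter_ringOfSetsType. Qed.

Section L2_theory.
Context {R : realType}.
Variables (a b : R).
Implicit Types f g h : R -> R.
Local Notation nu := (leb_itv a b).

Lemma ae_eq_forall f g : f = g %[ae nu] -> \forall x \ae nu, f x = g x.
Proof. by apply: filterS => x /(_ I). Qed.

Lemma leb_itv_setT : nu setT = lebesgue_measure `]a, b[%classic.
Proof. by rewrite -[RHS]/(lebesgue_measure _) -(setTI `]a, b[%classic). Qed.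

Lemma leb_itv_lty : (nu setT < +oo)%E.
Proof.
by rewrite leb_itv_setT lebesgue_measure_itv; case: ifP => //= _; rewrite -EFinB ltry.
Qed.

Lemma leb_itv_fin : nu setT \is a fin_num.
Proof. by rewrite ge0_fin_numE// leb_itv_lty. Qed.

Lemma L2_measurable f : L2 a b f -> bfun f.
Proof. by rewrite /L2/= inE => /andP[/[!inE]]. Qed.

Lemma L2D f g : L2 a b f -> L2 a b g -> L2 a b (f + g).
Proof.
move=> f2 g2; have [_ +] := Lfun_addr_closed nu (lee1n 2); exact.
Qed.

Lemma L2Z c f : L2 a b f -> L2 a b (c *: f).
Proof.
move=> f2; have r2 : (1 <= 2 :> R) by rewrite ler1n.
have := Lfun_scale c r2 f2; rewrite (_ : c \o* f = c *: f)//.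
by apply/funext => x; rewrite /= mulrC.
Qed.

Lemma L2N f : L2 a b f -> L2 a b (- f).
Proof. by move=> ?; rewrite -scaleN1r; exact: L2Z. Qed.

Lemma L2B f g : L2 a b f -> L2 a b g -> L2 a b (f - g).
Proof. by move=> f2 g2; apply: L2D => //; exact: L2N. Qed.

Lemma L20 : L2 a b 0.
Proof. have [+ _] := Lfun_addr_closed nu (lee1n 2); exact. Qed.

Lemma L2norm_ge0 f : 0 <= L2norm a b f.
Proof. by rewrite fine_ge0// Lnorm_ge0. Qed.

Lemma EFin_L2norm f : L2 a b f ->
  (L2norm a b f)%:E = ('N[nu]_2%:E[EFin \o f])%E.
Proof.
rewrite /L2/= inE => /andP[_ /[!inE] f2].
by rewrite /L2norm fineK// ge0_fin_numE// Lnorm_ge0.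
Qed.

Lemma L2normD f g : L2 a b f -> L2 a b g ->
  L2norm a b (f + g) <= L2norm a b f + L2norm a b g.
Proof.
move=> f2 g2; rewrite -lee_fin EFinD !EFin_L2norm//; last exact: L2D.
by apply: minkowski_EFin; [exact: L2_measurable|exact: L2_measurable|rewrite ler1n].
Qed.

(** Pointwise domination: all that the nonlinear terms (inverse squares, quotients)
    will need in order to be placed in [L2] and estimated there. *)
Lemma L2_ae_le c f g : 0 <= c -> bfun f -> L2 a b g ->
  (\forall x \ae nu, `|f x| <= c * `|g x|) ->
  L2 a b f /\ L2norm a b f <= c * L2norm a b g.
Proof.
move=> c0 mf g2 fg.
have cg2 : L2 a b (c *: g) by exact: L2Z.
have mg : bfun (c *: g : R -> R) by exact: L2_measurable.
have mpow (h : R -> R) : bfun h ->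
    measurable_fun setT (fun x => (`|(h x)%:E| `^ 2)%E).
  move=> mh; apply/measurable_EFinP/(measurableT_comp (measurable_powR _)).
  exact: measurableT_comp.
have le1 : ('N[nu]_2%:E[EFin \o f] <= 'N[nu]_2%:E[EFin \o (c *: g)])%E.
  rewrite unlock gt0_ler_poweR//.
  - by rewrite in_itv/= leey integral_ge0.
  - by rewrite in_itv/= leey integral_ge0.
  have mf2 := mpow _ mf; have mg2 := mpow _ mg.
  apply: ae_ge0_le_integral => //; move=> *; rewrite ?poweR_ge0//.
  apply: filterS fg => x /= fgx _.
  rewrite lee_fin ge0_ler_powR// ?nnegrE//.
  by rewrite fctE/= normrM (ger0_norm c0).
have f2 : L2 a b f.
  rewrite /L2/= inE; apply/andP; split; rewrite inE//=.
  by rewrite /finite_norm (le_lt_trans le1)// -EFin_L2norm// ltry.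
split=> //; rewrite -lee_fin EFin_L2norm// (le_trans le1)//.
rewrite -(ger0_norm c0) EFinM EFin_L2norm//.
have p1 : (1 <= 2%:E :> \bar R)%E by rewrite lee_fin ler1n.
have /= := @LnormZ _ _ _ nu 2%:E p1 (Lfun_Sub p1 g2) c.
by rewrite ger0_norm// => ->.
Qed.

Lemma L2_ae_eq f g : bfun f -> L2 a b g ->
  f = g %[ae nu] -> L2 a b f /\ L2norm a b f = L2norm a b g.
Proof.
move=> mf g2 fg.
have fg' := ae_eq_forall fg.
have fg1 : \forall x \ae nu, `|f x| <= 1 * `|g x|.
  by apply: filterS fg' => x ->; rewrite mul1r.
have gf1 : \forall x \ae nu, `|g x| <= 1 * `|f x|.
  by apply: filterS fg' => x ->; rewrite mul1r.
have [f2 le1] := L2_ae_le ler01 mf g2 fg1.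
have [_ le2] := L2_ae_le ler01 (L2_measurable g2) f2 gf1.
by split=> //; apply/eqP; rewrite eq_le; rewrite !mul1r in le1 le2; rewrite le1 le2.
Qed.

Lemma L2normZ c f : L2 a b f -> L2norm a b (c *: f) = `|c| * L2norm a b f.
Proof.
move=> f2.
have p1 : (1 <= 2%:E :> \bar R)%E by rewrite lee_fin ler1n.
have /= H := @LnormZ _ _ _ nu 2%:E p1 (Lfun_Sub p1 f2) c.
by apply: EFin_inj; rewrite EFinM !EFin_L2norm//; exact: L2Z.
Qed.

Lemma L2_cst c : L2 a b (cst c).
Proof.
rewrite /L2/= inE; apply/andP; split; rewrite inE//=.
rewrite /finite_norm unlock poweR_lty//= integral_cst//=.
by rewrite lte_mul_pinfty ?lee_fin ?powR_ge0//; exact: leb_itv_lty.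
Qed.

Lemma L2_integrable f : L2 a b f -> nu.-integrable setT (EFin \o f).
Proof. by move=> f2; apply/Lfun1_integrable/(Lfun_subset12 leb_itv_fin). Qed.

Lemma integral_leb_itv (f : R -> \bar R) :
  bfun f ->
  (\int[nu]_x f x = \int[lebesgue_measure]_(x in `]a, b[) f x)%E.
Proof.
move=> mf.
have mI : measurable (`]a, b[%classic : set R) by exact: measurable_itv.
rewrite -(setUv `]a, b[%classic) integral_setU//=.
- rewrite [X in (_ + X)%E](_ : _ = 0)%E ?adde0.
    apply: eq_measure_integral => A mA AI.
    by rewrite /leb_itv /mrestr/=; congr (lebesgue_measure _); exact/setIidPl.
  apply: null_set_integral; [exact: measurableC| |].
  - exact: measurable_funTS.
  - rewrite -[LHS]/(lebesgue_measure (~` `]a, b[%classic `&` `]a, b[%classic)).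
    by rewrite setICl measure0.
- exact: measurableC.
- by rewrite setUv.
- by apply/disj_setPS; rewrite setICr.
Qed.

End L2_theory.

(** * Smooth bumps *)

Section smooth_bumps.
Context {R : realType}.
Implicit Types f g : R -> R.

(** The family is closed under differentiation up to linear combinations, which
    makes smoothness an induction that never computes an iterated derivative. *)
Definition flat (k : nat) (x : R) : R :=
  if 0 < x then x^-1 ^+ k * expR (- x^-1) else 0.

Lemma flat_ge0 k x : 0 <= flat k x.
Proof.
rewrite /flat; case: ifPn => // x0.
by rewrite mulr_ge0 ?expR_ge0// exprn_ge0// invr_ge0 ltW.
Qed.

Lemma flat0_le1 x : flat 0 x <= 1.
Proof.
rewrite /flat; case: ifPn => // x0.
by rewrite expr0 mul1r -[leRHS]expR0 ler_expR oppr_le0 invr_ge0 ltW.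
Qed.

(** Since exp(1 / x) >= (1 / x)^(k+1) / (k+1)!, the factor exp(- 1 / x) beats the
    pole x^(-k); this linear bound is what differentiability at 0 requires. *)
Lemma flat_le k x : flat k x <= (k.+1)`!%:R * `|x|.
Proof.
rewrite /flat; case: ifPn => x0; last by rewrite mulr_ge0.
rewrite (gtr0_norm x0) expRN ler_pdivrMr ?expR_gt0//.
have y0 : 0 <= x^-1 by rewrite invr_ge0 ltW.
have := expR_ge1Dxn k y0 => le_exp.
have fac0 : 0 < (k.+1)`!%:R :> R by rewrite ltr0n fact_gt0.
have : x^-1 ^+ k.+1 / (k.+1)`!%:R <= expR x^-1 by rewrite (le_trans _ le_exp)// lerDr.
rewrite ler_pdivrMr// => H.
have -> : x^-1 ^+ k = x^-1 ^+ k.+1 * x by rewrite exprS mulrAC mulVf ?mul1r ?gt_eqF.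
by rewrite mulrAC ler_pM2r// mulrC.
Qed.

Lemma flatS k x : flat k x = flat k.+1 x * x.
Proof.
rewrite /flat; case: ifPn => x0; last by rewrite mul0r.
by rewrite exprS; field; rewrite gt_eqF.
Qed.

(** The three regimes are glued at 0, where the difference quotient of [flat k]
    is [flat k.+1] and tends to 0 by [flat_le]. *)
Lemma is_derive_flat k (x : R) :
  is_derive x 1 (flat k) (flat k.+2 x - k%:R * flat k.+1 x).
Proof.
have [x0|x0|->] := ltgtP x 0.
- rewrite [X in is_derive _ _ _ X](_ : _ = 0); last first.
    by rewrite /flat ltNge (ltW x0)/= mulr0 subr0.
  apply: (@near_eq_is_derive _ _ _ (cst 0)); rewrite ?oner_eq0//.
  near=> y; rewrite /flat ifF//; apply/negbTE; rewrite -leNgt.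
  by near: y; apply: filterS (lt_nbhsl x0) => y; exact: ltW.
- pose F y : R := y^-1 ^+ k * expR (- y^-1).
  apply: (@near_eq_is_derive _ _ _ F); rewrite ?oner_eq0//.
    near=> y; rewrite /flat ifT//; near: y; exact: lt_nbhsr.
  have xN0 : x != 0 by rewrite gt_eqF.
  have dV : is_derive x 1 (fun y : R => y^-1) (- x ^- 2).
    by apply: is_derive_eq; [exact: is_deriveV|rewrite scaler1].
  have dE : is_derive x 1 (fun y : R => expR (- y^-1)) (expR (- x^-1) * x ^- 2).
    have := @is_derive1_comp R expR (fun y => - y^-1) x _ _
      (is_derive_expR (- x^-1)) (is_deriveN dV).
    by rewrite opprK.
  have dX : is_derive x 1 (fun y : R => y^-1 ^+ k)
      (k%:R * x^-1 ^+ k.-1 * - x ^- 2).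
    have -> : (fun y : R => y^-1 ^+ k) = (GRing.inv : R -> R) ^+ k.
      by apply/funext => y; rewrite fctE.
    exact: is_deriveX.
  have -> : F = (fun y : R => y^-1 ^+ k) * (fun y : R => expR (- y^-1)) by [].
  apply: (is_derive_eq (is_deriveM dX dE)).
  rewrite /flat !ifT// /GRing.scale/=.
  case: (k) => [|n] /=; rewrite ?expr0 ?mul0r ?mulr0n.
    by field.
  by rewrite !exprS; field.
- rewrite [X in is_derive _ _ _ X](_ : _ = 0); last first.
    by rewrite /flat ltxx mulr0 subr0.
  have H : h^-1 *: (flat k (h *: 1 + 0) - flat k 0) @[h --> (0 : R)^'] --> (0 : R).
    apply/cvgrPdist_le => e e0; near=> h.
    rewrite sub0r normrN addr0 /GRing.scale/= mulr1 {2}/flat ltxx subr0 flatS.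
    have h0 : h != 0 by near: h; exact: nbhs_dnbhs_neq.
    rewrite mulrC mulfK// ger0_norm ?flat_ge0//.
    rewrite (le_trans (flat_le _ _))// mulrC -ler_pdivlMr ?ltr0n ?fact_gt0//.
    near: h; apply: dnbhs0_le; rewrite divr_gt0// ltr0n fact_gt0//.
  by apply: DeriveDef; [apply/cvg_ex; exists 0|apply/cvg_lim].
Unshelve. all: by end_near. Qed.

(** A class of functions stable under differentiation, hence consisting of smooth
    functions. *)
Inductive flat_algebra : (R -> R) -> Prop :=
| flat_algebra_cst c : flat_algebra (cst c)
| flat_algebra_flat k p q : flat_algebra (fun x => flat k (p * x + q))
| flat_algebraD f g : flat_algebra f -> flat_algebra g -> flat_algebra (f + g)
| flat_algebraM f g : flat_algebra f -> flat_algebra g -> flat_algebra (f * g).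

Lemma flat_algebra_derive f : flat_algebra f ->
  exists2 g, flat_algebra g & forall x : R, is_derive x 1 f (g x).
Proof.
elim=> [c|k p q|{}f g Af [f' Af' ff'] Ag [g' Ag' gg']
       |{}f g Af [f' Af' ff'] Ag [g' Ag' gg']].
- by exists (cst 0); [exact: flat_algebra_cst|move=> x; exact: is_derive_cst].
- exists (cst p * ((fun x => flat k.+2 (p * x + q)) +
                   cst (- k%:R) * (fun x => flat k.+1 (p * x + q)))).
    do ?[apply: flat_algebraM|apply: flat_algebraD|exact: flat_algebra_cst
        |exact: flat_algebra_flat].
  move=> x.
  have d1 : is_derive x 1 (fun y : R => p * y + q) p.
    by apply: is_derive_eq; rewrite /GRing.scale/= ?mulr1 ?mulr0 ?addr0.
  have d2 := is_derive_flat k (p * x + q).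
  apply: is_derive_eq.
  by rewrite !fctE mulrC mulNr.
- exists (f' + g'); first exact: flat_algebraD.
  by move=> x; exact: is_deriveD.
- exists (f * g' + g * f').
    by apply: flat_algebraD; exact: flat_algebraM.
  by move=> x; exact: is_deriveM.
Qed.

Lemma flat_algebra_derivable f n (x : R) : flat_algebra f -> derivable (f^`(n))%classic x 1.
Proof.
move=> Af; have : flat_algebra (f^`(n))%classic.
  elim: n => [|n /flat_algebra_derive[g Ag gE]]; first by rewrite derive1n0.
  rewrite derive1nS (_ : (_^`())%classic = g)//; apply/funext => y.
  by rewrite derive1E; exact: derive_val.
by move=> /flat_algebra_derive[g _ /(_ x)] H; exact: (@ex_derive _ _ _ _ _ _ _ H).
Qed.

(** The shift by - 1 in the first factor keeps the support at distance 1 / (n + 1)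
    from a, hence compact in ]a, b[, although the bumps converge to the
    indicator of the whole of ]a, x[. *)
Definition flat_bump (a x : R) (n : nat) (y : R) : R :=
  flat 0 (n.+1%:R * y + (- n.+1%:R * a - 1)) *
  flat 0 (- n.+1%:R * y + n.+1%:R * x).

Lemma test_function_flat_bump a b x n : x < b -> test_function a b (flat_bump a x n).
Proof.
move=> xb; split.
  by move=> m y; apply: flat_algebra_derivable;
    apply: flat_algebraM; exact: flat_algebra_flat.
have n0 : 0 < n.+1%:R :> R by rewrite ltr0n.
exists `[a + n.+1%:R^-1, x]%classic; split; first exact: segment_compact.
  move=> y /=; rewrite !in_itv/= => /andP[ay yx].
  by rewrite (lt_le_trans _ ay) ?ltrDl ?invr_gt0// (le_lt_trans yx).
move=> y /=; rewrite in_itv/= => /negP; rewrite negb_and -!ltNge /flat_bump.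
move=> /orP[ya|xy].
  rewrite {1}/flat ifF ?mul0r//; apply/negbTE; rewrite -leNgt.
  have : n.+1%:R * y <= n.+1%:R * (a + n.+1%:R^-1) by rewrite ler_pM2l// ltW.
  by rewrite mulrDr divff ?gt_eqF//; lra.
rewrite mulrC {1}/flat ifF ?mul0r//; apply/negbTE; rewrite -leNgt.
by rewrite mulNr addrC subr_le0 ler_pM2l// ltW.
Qed.

Lemma flat_bump_ge0 a x n y : 0 <= flat_bump a x n y.
Proof. by rewrite mulr_ge0// flat_ge0. Qed.

Lemma flat_bump_le1 a x n y : flat_bump a x n y <= 1.
Proof. by rewrite mulr_ile1// ?flat_ge0 ?flat0_le1. Qed.

Lemma flat_bump_out a x n y : y \notin `]a, x[ -> flat_bump a x n y = 0.
Proof.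
have n0 : 0 < n.+1%:R :> R by rewrite ltr0n.
rewrite in_itv/= negb_and -!leNgt /flat_bump => /orP[ya|xy].
  rewrite {1}/flat ifF ?mul0r//; apply/negbTE; rewrite -leNgt.
  have : n.+1%:R * y <= n.+1%:R * a by rewrite ler_pM2l.
  by lra.
rewrite mulrC {1}/flat ifF ?mul0r//; apply/negbTE; rewrite -leNgt.
by rewrite mulNr addrC subr_le0 ler_pM2l.
Qed.

Lemma cvg_flat0 (t c : R) : 0 < t ->
  flat 0 (n.+1%:R * t - c) @[n --> \oo] --> (1 : R).
Proof.
move=> t0.
have uy : (n.+1%:R * t - c) @[n --> \oo] --> +oo.
  apply/cvgryPge => A; near=> n.
  rewrite lerBrDr -ler_pdivrMr// (@le_trans _ _ n%:R)// ?ler_nat//.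
  by near: n; exact: nbhs_infty_ger.
have uV : (n.+1%:R * t - c)^-1 @[n --> \oo] --> (0 : R).
  apply/gtr0_cvgV0 => //; near=> n.
  by near: n; move/cvgryPgt : uy; exact.
have : expR (- (n.+1%:R * t - c)^-1) @[n --> \oo] --> expR (- 0 : R).
  by apply: continuous_cvg; [exact: continuous_expR|exact: cvgN].
rewrite oppr0 expR0; apply: cvg_trans; apply: near_eq_cvg; near=> n.
rewrite /flat ifT ?expr0 ?mul1r//.
by near: n; move/cvgryPgt : uy; exact.
Unshelve. all: by end_near. Qed.

Lemma cvg_flat_bump a x y : y \in `]a, x[ -> flat_bump a x n y @[n --> \oo] --> (1 : R).
Proof.
rewrite in_itv/= => /andP[ay yx]; rewrite -[X in _ --> X](mulr1 1).
apply: cvgM.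
  have := @cvg_flat0 (y - a) 1; rewrite subr_gt0 => /(_ ay).
  suff -> : (fun n => flat 0 (n.+1%:R * (y - a) - 1)) =
    (fun n => flat 0 (n.+1%:R * y + (- n.+1%:R * a - 1))) by [].
  apply/funext => n; congr flat; ring.
have := @cvg_flat0 (x - y) 0; rewrite subr_gt0 => /(_ yx).
suff -> : (fun n => flat 0 (n.+1%:R * (x - y) - 0)) =
  (fun n => flat 0 (- n.+1%:R * y + n.+1%:R * x)) by [].
apply/funext => n; congr flat; ring.
Qed.

End smooth_bumps.

(** * Test functions and weak derivatives *)

Section test_functions.
Context {R : realType}.
Variables (a b : R).
Implicit Types f g phi : R -> R.
Local Notation nu := (leb_itv a b).

Lemma test_function_derivable phi : test_function a b phi ->
  forall x, derivable phi x 1.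
Proof. by move=> [dphi _] x; have := dphi 0%N x; rewrite derive1n0. Qed.

Lemma derivable_continuousT f : (forall x, derivable f x 1) -> continuous f.
Proof. by move=> df x; apply/differentiable_continuous/derivable1_diffP. Qed.

Lemma test_function_continuous phi : test_function a b phi -> continuous phi.
Proof. by move=> tphi; apply/derivable_continuousT/test_function_derivable. Qed.

Lemma test_function_out phi : test_function a b phi ->
  forall x, x \notin `]a, b[ -> phi x = 0.
Proof.
move=> [_ [K [_ Kab K0]]] x xab; apply: K0 => /Kab /=.
by rewrite (negbTE xab).
Qed.

Lemma test_function_derive phi : test_function a b phi ->
  test_function a b (phi^`())%classic.
Proof.
move=> [dphi [K [cK Kab K0]]]; split.
  move=> n x; have := dphi n.+1 x; congr (derivable _ x 1).
  elim: n => [|n IH]; first by rewrite derive1n1 derive1n0.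
  by rewrite derive1nS IH derive1nS.
exists K; split=> // x Kx.
have oK : open (~` K).
  by apply: closed_openC; apply: compact_closed => //; exact: Rhausdorff.
rewrite derive1E (@near_eq_derive _ _ _ _ (cst 0)) ?derive_cst// ?oner_eq0//.
have := open_nbhs_nbhs (conj oK Kx).
by apply: filterS => y; exact: K0.
Qed.

Lemma test_function_bounded phi : test_function a b phi ->
  exists2 M, 0 <= M & forall x, `|phi x| <= M.
Proof.
move=> tphi.
have cphi : {within `[a, b], continuous phi}.
  exact/continuous_subspaceT/test_function_continuous.
have [M [_ HM]] := compact_bounded (continuous_compact cphi (@segment_compact R a b)).
exists (`|M| + 1) => [|x]; first by rewrite addr_ge0.
have [xab|/(test_function_out tphi) ->] := boolP (x \in `]a, b[); last first.
  by rewrite normr0 addr_ge0.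
apply: HM; first by rewrite (le_lt_trans (ler_norm M))// ltrDl.
by exists x => //; exact: subset_itv_oo_cc.
Qed.

Lemma continuous_bfun f : continuous f -> bfun f.
Proof. exact: continuous_measurable_fun. Qed.

Lemma test_function_L2 phi : test_function a b phi -> L2 a b phi.
Proof.
move=> tphi; have [M M0 HM] := test_function_bounded tphi.
have mphi := continuous_bfun (test_function_continuous tphi).
apply: (proj1 (@L2_ae_le _ a b 1 phi (cst M) ler01 mphi (L2_cst _ _ M) _)).
by apply: aeW => x; rewrite mul1r (ger0_norm M0).
Qed.

Lemma L2_mul_integrable f g : L2 a b f -> L2 a b g ->
  nu.-integrable setT (EFin \o (fun x => f x * g x)).
Proof. by move=> f2 g2; apply/Lfun1_integrable/Lfun2_mul_Lfun1. Qed.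

Lemma Rintegral_leb_itv f : bfun f ->
  Rintegral nu setT f = Rintegral lebesgue_measure `[a, b]%classic f.
Proof.
move=> mf; rewrite /Rintegral integral_leb_itv; last exact/measurable_EFinP.
rewrite [in RHS]integral_itv_bndoo//; apply/measurable_EFinP.
exact: measurable_funTS.
Qed.

Hypothesis ab : a < b.

(** Taking f constant or a test function shows that constants and test functions
    belong to [H1]. *)
Lemma test_function_parts f f' phi : (forall x : R, is_derive x 1 f (f' x)) ->
  continuous f' -> test_function a b phi ->
  Rintegral nu setT (fun x => f x * (phi^`())%classic x) =
  - Rintegral nu setT (fun x => f' x * phi x).
Proof.
move=> df cf' tphi.
have dphi := test_function_derivable tphi.
have tphi' := test_function_derive tphi.
have cf : continuous f by apply: derivable_continuousT => x; exact: ex_derive.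
have cphi := test_function_continuous tphi.
have cphi' := test_function_continuous tphi'.
have LR (h : R -> R) : (forall x, derivable h x 1) -> derivable_oo_LRcontinuous h a b.
  move=> dh; have ch := derivable_continuousT dh.
  by split=> [x _||]; [|exact/cvg_at_right_filter/ch|exact/cvg_at_left_filter/ch].
rewrite !Rintegral_leb_itv; last 2 first.
- by apply: continuous_bfun => x; apply: cvgM; [exact: cf'|exact: cphi].
- by apply: continuous_bfun => x; apply: cvgM; [exact: cf|exact: cphi'].
rewrite (@Rintegration_by_parts _ f phi f' (phi^`())%classic a b ab).
- rewrite (test_function_out tphi (x := b)) ?in_itv/= ?ltxx ?andbF//.
  rewrite (test_function_out tphi (x := a)) ?in_itv/= ?ltxx//.
  by rewrite !mulr0 subrr sub0r.
- exact: continuous_subspaceT.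
- by apply: LR => x; exact: ex_derive.
- by move=> x _; rewrite derive1E; exact: derive_val.
- exact: continuous_subspaceT.
- exact: LR.
- by [].
Qed.

Lemma weak_derivative_test_function phi : test_function a b phi ->
  weak_derivative a b phi (phi^`())%classic.
Proof.
move=> tphi psi tpsi; apply: test_function_parts => // [x|].
  by rewrite derive1E; exact/derivableP/test_function_derivable.
exact/test_function_continuous/test_function_derive.
Qed.

Lemma weak_derivative_cst c : weak_derivative a b (cst c) (cst 0).
Proof. by move=> psi tpsi; apply: test_function_parts => // x; exact: cvg_cst. Qed.

Lemma weak_derivativeZD c f1 f2 g1 g2 :
  L2 a b f1 -> L2 a b f2 -> L2 a b g1 -> L2 a b g2 ->
  weak_derivative a b f1 g1 -> weak_derivative a b f2 g2 ->
  weak_derivative a b (c *: f1 + f2) (c *: g1 + g2).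
Proof.
move=> f12 f22 g12 g22 w1 w2 phi tphi.
have phi2 := test_function_L2 tphi.
have phi'2 := test_function_L2 (test_function_derive tphi).
have lin (h1 h2 psi : R -> R) : L2 a b h1 -> L2 a b h2 -> L2 a b psi ->
    Rintegral nu setT (fun x => (c *: h1 + h2) x * psi x) =
    c * Rintegral nu setT (fun x => h1 x * psi x) +
    Rintegral nu setT (fun x => h2 x * psi x).
  move=> h12 h22 psi2.
  rewrite -RintegralZl//; last exact: L2_mul_integrable.
  rewrite -RintegralD//; last 2 first.
  - have := L2_mul_integrable (L2Z c h12) psi2; congr (integrable _ _ _).
    by apply/funext => x /=; rewrite -mulrA.
  - exact: L2_mul_integrable.
  by congr fine; apply: eq_integral => x _; congr EFin; rewrite !fctE/= mulrDl mulrA.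
by rewrite !lin// w1// w2//; ring.
Qed.

(** Fundamental lemma of the calculus of variations.  By dominated convergence the
    bumps give a vanishing integral of g over ]a, y[ for every y; the derivative of
    that integral is g almost everywhere. *)
Lemma L2_ae0 g : L2 a b g ->
  (forall phi, test_function a b phi -> Rintegral nu setT (fun x => g x * phi x) = 0) ->
  g = 0 %[ae nu].
Proof.
move=> g2 g0.
have mg := L2_measurable g2.
have mEg : bfun (EFin \o g) by apply/measurable_EFinP.
have mI (x y : R) : measurable (`]x, y[%classic : set R) by exact: measurable_itv.
(* The differentiation theorem wants a function on the whole line. *)
pose h := g \_ `]a, b[%classic.
have intg : lebesgue_measure.-integrable `]a, b[%classic (EFin \o g).
  have /integrableP[_ gfin] := L2_integrable g2.
  apply/integrableP; split; first exact: measurable_funTS.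
  by rewrite -integral_leb_itv//; exact: measurableT_comp.
have locg : locally_integrable setT h by exact: integrable_locally.
have inth y : lebesgue_measure.-integrable [set` Interval (BRight a) (BRight y)] (EFin \o h).
  apply: (@integrableS _ _ _ _ setT) => //.
  rewrite -restrict_EFin; apply/integrable_restrict => //.
  by rewrite setTI.
have F0 y : a < y < b -> Rintegral lebesgue_measure [set` Interval (BRight a) (BRight y)] h = 0.
  move=> /andP[ay yb].
  pose I := `]a, y[%classic : set R.
  have bumpM n : Rintegral nu setT (fun x => g x * flat_bump a y n x) = 0.
    by apply: g0; exact: test_function_flat_bump.
  have mb n : bfun (flat_bump a y n).
    exact: continuous_bfun (test_function_continuous (test_function_flat_bump a n yb)).
  have mf n : bfun (EFin \o (fun x => g x * flat_bump a y n x)).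
    by apply/measurable_EFinP/measurable_funM.
  have mgI : bfun ((EFin \o g) \_ I).
    by apply/(measurable_restrictT _ _).1; [exact: mI|exact: measurable_funTS].
  have intg1 : nu.-integrable setT (EFin \o (fun x => `|g x|)).
    by have := integrable_abse (L2_integrable g2).
  have cvg_f x : setT x -> EFin (g x * flat_bump a y n x) @[n --> \oo] --> ((EFin \o g) \_ I) x.
    move=> _; rewrite patchE; case: ifPn => [|] xI.
      apply: cvg_EFin; first exact: nearW.
      rewrite -[X in _ --> X]mulr1; apply: cvgMr.
      by apply: cvg_flat_bump; move: xI; rewrite inE.
    rewrite (_ : (fun n => _) = cst 0%E); first exact: cvg_cst.
    apply/funext => n; rewrite flat_bump_out ?mulr0//.
    by apply: contra xI => xI; rewrite inE.
  have dom x n : setT x -> (`|(g x * flat_bump a y n x)%:E| <= `|g x|%:E)%E.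
    move=> _; rewrite lee_fin normrM ler_piMr// ger0_norm ?flat_bump_ge0//.
    exact: flat_bump_le1.
  have [| | | | |_ _] := @dominated_convergence _ _ _ nu setT measurableT
    (fun n => EFin \o (fun x => g x * flat_bump a y n x)) ((EFin \o g) \_ I)
    (EFin \o (fun x => `|g x|)).
  - exact: mf.
  - exact: mgI.
  - by apply: aeW => x; exact: cvg_f.
  - exact: intg1.
  - by apply: aeW => x n; exact: dom.
  rewrite integral_leb_itv// -integral_mkcondr.
  have -> : `]a, b[%classic `&` I = I.
    apply/setIidPr => x; rewrite /I /= !in_itv/= => /andP[-> xy].
    exact: lt_trans yb.
  move=> lim_int.
  rewrite /Rintegral (@integral_itv_bndoo _ a y _ false false); last first.
    apply/measurable_EFinP/measurable_funTS.
    by apply/(measurable_restrictT _ _).1 => //; exact: measurable_funTS.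
  suff -> : (\int[lebesgue_measure]_(z in `]a, y[) (h z)%:E = 0)%E by [].
  have -> : (\int[lebesgue_measure]_(z in `]a, y[) (h z)%:E =
      \int[lebesgue_measure]_(z in I) (EFin \o g) z)%E.
    apply: eq_integral => z; rewrite inE => zI; congr EFin; rewrite /h patchE ifT//.
    by rewrite inE; move: zI; rewrite /= !in_itv/= => /andP[-> zy]; exact: lt_trans yb.
  rewrite -(cvg_lim _ lim_int)//; apply: cvg_lim => //.
  rewrite (_ : [sequence _]_n = cst 0%E); first exact: cvg_cst.
  apply/funext => n /=; rewrite -[LHS]fineK; first by congr EFin; exact: bumpM.
  apply: integrable_fin_num => //; apply: L2_mul_integrable => //.
  exact/test_function_L2/test_function_flat_bump.
have [N [mN N0 NP]] := FTC1 inth locg.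
exists (N `|` ~` `]a, b[%classic); split.
- by apply: measurableU => //; exact: measurableC.
- apply/eqP; rewrite -measure_le0.
  rewrite -[leLHS]/(lebesgue_measure ((N `|` ~` `]a, b[%classic) `&` `]a, b[%classic)).
  rewrite setIUl setICl setU0 -N0 le_measure// ?inE//; exact: measurableI.
- move=> x /= gx; have [xab|] := boolP (x \in `]a, b[); last first.
    by move=> xab; right => /= xab'; rewrite xab' in xab.
  left; apply: NP => /= Fx; apply: gx => _; move: (xab); rewrite in_itv/= => /andP[ax xb].
  have Fx1 := Fx (ax : (BRight a < BRight x)%O).
  have [] := Fx1.
  move=> _; rewrite derive1E (@near_eq_derive _ _ _ _ (cst 0)) ?oner_eq0//; last first.
    near=> y; apply: F0; apply/andP; split; near: y.
      exact: lt_nbhsr.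
    exact: lt_nbhsl.
  by rewrite derive_cst /h patchE ifT ?inE.
Unshelve. all: by end_near. Qed.

End test_functions.

(** * Seminormed spaces *)

(** The spaces of functions are sets of representatives, on which the norms are
    only seminorms satisfying the axioms on the set [D]. *)
Record seminormed {R : realType} {V : lmodType R} (D : set V) (N : V -> R) : Prop := {
  seminormed0 : D 0;
  seminormedZD : forall c x y, D x -> D y -> D (c *: x + y);
  seminorm_ge0 : forall x, 0 <= N x;
  seminormD : forall x y, D x -> D y -> N (x + y) <= N x + N y;
  seminormZ : forall c x, D x -> N (c *: x) = `|c| * N x }.

Section seminormed_theory.
Context {R : realType} {V : lmodType R} (D : set V) (N : V -> R).
Hypothesis DN : seminormed D N.
Implicit Types x y z : V.

Lemma seminormed_add x y : D x -> D y -> D (x + y).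
Proof. by move=> Dx Dy; rewrite -[x]scale1r; exact: (seminormedZD DN). Qed.

Lemma seminormed_scale c x : D x -> D (c *: x).
Proof.
by move=> Dx; rewrite -[X in D X]addr0; apply: (seminormedZD DN) => //;
  exact: seminormed0 DN.
Qed.

Lemma seminormed_opp x : D x -> D (- x).
Proof. by move=> Dx; rewrite -scaleN1r; exact: seminormed_scale. Qed.

Lemma seminormed_sub x y : D x -> D y -> D (x - y).
Proof. by move=> Dx Dy; apply: seminormed_add => //; exact: seminormed_opp. Qed.

Lemma seminorm0 : N 0 = 0.
Proof. by rewrite -(scale0r 0) (seminormZ DN) ?normr0 ?mul0r//; exact: seminormed0 DN. Qed.

Lemma seminormN x : D x -> N (- x) = N x.
Proof. by move=> Dx; rewrite -scaleN1r (seminormZ DN)// normrN1 mul1r. Qed.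

Lemma seminormBC x y : D x -> D y -> N (x - y) = N (y - x).
Proof. by move=> Dx Dy; rewrite -seminormN ?opprB//; exact: seminormed_sub. Qed.

Lemma seminormB x y : D x -> D y -> N (x - y) <= N x + N y.
Proof.
move=> Dx Dy; rewrite -(seminormN Dy); apply: (seminormD DN) => //.
exact: seminormed_opp.
Qed.

Lemma seminorm_triangle y x z : D x -> D y -> D z ->
  N (x - z) <= N (x - y) + N (y - z).
Proof.
move=> Dx Dy Dz; rewrite -[X in N X <= _](subrKA y).
by apply: (seminormD DN); exact: seminormed_sub.
Qed.

Lemma seminormed_sum n (x : nat -> V) : (forall i, (i < n)%N -> D (x i)) ->
  D (\sum_(i < n) x i).
Proof.
elim: n => [|n IH] Dx; first by rewrite big_ord0; exact: seminormed0 DN.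
rewrite big_ord_recr/=; apply: seminormed_add; last exact: Dx.
by apply: IH => i ni; apply: Dx; exact: ltnW.
Qed.

Lemma seminorm_sum n (x : nat -> V) : (forall i, (i < n)%N -> D (x i)) ->
  N (\sum_(i < n) x i) <= \sum_(i < n) N (x i).
Proof.
elim: n => [|n IH] Dx; first by rewrite !big_ord0 seminorm0.
have Dx' i : (i < n)%N -> D (x i) by move=> ni; apply: Dx; exact: ltnW.
rewrite !big_ord_recr/= (le_trans (seminormD DN _ _))//; first exact: seminormed_sum.
  exact: Dx.
by rewrite lerD2r; exact: IH.
Qed.

End seminormed_theory.

Section euclidean_combination.
Context {R : realType}.

Lemma sqrt_sum_sqr_triangle (x1 y1 x2 y2 x y : R) :
  0 <= x -> 0 <= y -> x <= x1 + x2 -> y <= y1 + y2 ->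
  Num.sqrt (x ^+ 2 + y ^+ 2) <=
  Num.sqrt (x1 ^+ 2 + y1 ^+ 2) + Num.sqrt (x2 ^+ 2 + y2 ^+ 2).
Proof.
move=> x0 y0 xle yle.
have p0 (u v : R) : 0 <= u ^+ 2 + v ^+ 2 by rewrite addr_ge0 ?sqr_ge0.
rewrite -(@ler_pXn2r _ 2)// ?nnegrE ?addr_ge0 ?sqrtr_ge0//.
rewrite sqrrD !sqr_sqrtr//.
suff : x1 * x2 + y1 * y2 <=
    Num.sqrt (x1 ^+ 2 + y1 ^+ 2) * Num.sqrt (x2 ^+ 2 + y2 ^+ 2).
  by move=> H; nra.
rewrite -sqrtrM// (le_trans (ler_norm _))// -sqrtr_sqr ler_wsqrtr//.
have := sqr_ge0 (x1 * y2 - x2 * y1).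
by nra.
Qed.

Lemma sqrt_sum_sqrM (c x y : R) :
  Num.sqrt ((`|c| * x) ^+ 2 + (`|c| * y) ^+ 2) = `|c| * Num.sqrt (x ^+ 2 + y ^+ 2).
Proof. by rewrite !exprMn -mulrDr sqrtrM ?sqr_ge0// sqrtr_sqr normr_id. Qed.

Lemma le_sqrt_sum_sqrl (x y : R) : 0 <= x -> x <= Num.sqrt (x ^+ 2 + y ^+ 2).
Proof.
by move=> x0; rewrite -[leLHS]ger0_norm// -sqrtr_sqr ler_wsqrtr// lerDl sqr_ge0.
Qed.

Lemma le_sqrt_sum_sqrr (x y : R) : 0 <= y -> y <= Num.sqrt (x ^+ 2 + y ^+ 2).
Proof. by rewrite addrC; exact: le_sqrt_sum_sqrl. Qed.

End euclidean_combination.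

(** * The seminorms of L2, H1 and the phase space *)

Section sobolev_seminorms.
Context {R : realType}.
Variables (a b : R).
Implicit Types f g phi : R -> R.
Local Notation nu := (leb_itv a b).

Lemma seminormed_L2 : seminormed (L2 a b) (L2norm a b).
Proof.
split; [exact: L20| |exact: L2norm_ge0|exact: L2normD|exact: L2normZ].
by move=> c f g f2 g2; apply: L2D => //; exact: L2Z.
Qed.

Lemma test_functionZD c phi psi : test_function a b phi ->
  test_function a b psi -> test_function a b (c *: phi + psi).
Proof.
move=> [dphi [K [cK Kab K0]]] [dpsi [K' [cK' Kab' K0']]]; split; last first.
  exists (K `|` K'); split; [exact: compactU|by rewrite subUset|].
  by move=> x /not_orP[Kx Kx']; rewrite !fctE K0// K0'// scaler0 addr0.
have E n : ((c *: phi + psi)^`(n))%classic =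
    c *: (phi^`(n))%classic + (psi^`(n))%classic.
  elim: n => [|n IH]; first by rewrite !derive1n0.
  rewrite !derive1nS IH; apply/funext => x; rewrite derive1E deriveD//; last first.
    exact: derivableZ.
  by rewrite deriveZ// -!derive1E.
by move=> n x; rewrite E; apply: derivableD => //; exact: derivableZ.
Qed.

Lemma wDP f : H1 a b f -> L2 a b (wD a b f) /\ weak_derivative a b f (wD a b f).
Proof.
move=> [f2 [g g2 fg]].
exact: (@xgetPex _ (0 : R -> R) [set g | L2 a b g /\ weak_derivative a b f g]
  (ex_intro _ g (conj g2 fg))).
Qed.

Lemma H1_L2 f : H1 a b f -> L2 a b f.
Proof. by case. Qed.

Lemma L2_wD f : H1 a b f -> L2 a b (wD a b f).
Proof. by case/wDP. Qed.

Lemma H1norm_ge0 f : 0 <= H1norm a b f.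
Proof. exact: sqrtr_ge0. Qed.

Lemma L2norm_le_H1norm f : L2norm a b f <= H1norm a b f.
Proof. by apply: le_sqrt_sum_sqrl; exact: L2norm_ge0. Qed.

Lemma L2norm_le_H2norm f : L2norm a b f <= H2norm a b f.
Proof.
rewrite -[leLHS]ger0_norm ?L2norm_ge0// -sqrtr_sqr ler_wsqrtr//.
by rewrite -addrA lerDl addr_ge0 ?sqr_ge0.
Qed.

Hypothesis ab : a < b.

Lemma weak_derivative_unique f g1 g2 : L2 a b g1 -> L2 a b g2 ->
  weak_derivative a b f g1 -> weak_derivative a b f g2 -> g1 = g2 %[ae nu].
Proof.
move=> g12 g22 w1 w2.
have gB : L2 a b (g1 - g2) by exact: L2B.
suff : g1 - g2 = 0 %[ae nu].
  move=> /ae_eq_forall; apply: filterS => x H _.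
  by apply/eqP; rewrite -subr_eq0; apply/eqP; exact: H.
apply: L2_ae0 => // phi tphi; have phi2 := test_function_L2 tphi.
under eq_Rintegral do rewrite !fctE mulrBl.
rewrite RintegralB//; [|exact: L2_mul_integrable|exact: L2_mul_integrable].
have := w1 phi tphi; rewrite w2// => /oppr_inj ->.
by rewrite subrr.
Qed.

(** Any weak derivative computes the norm, which frees all further arguments from
    the choice made by [wD]. *)
Lemma H1_weak_derivative f g : L2 a b f -> L2 a b g -> weak_derivative a b f g ->
  H1 a b f /\ L2norm a b (wD a b f) = L2norm a b g.
Proof.
move=> f2 g2 fg; have f1 : H1 a b f by split=> //; exists g.
have [Df2 fDf] := wDP f1; split=> //.
apply: (proj2 (L2_ae_eq (L2_measurable Df2) g2 _)).
exact: weak_derivative_unique fDf fg.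
Qed.

Lemma H1_cst c : H1 a b (cst c).
Proof. by split; [exact: L2_cst|exists (cst 0); [exact: L2_cst|exact: weak_derivative_cst]]. Qed.

Lemma test_function_H1 phi : test_function a b phi -> H1 a b phi.
Proof.
move=> tphi; split; first exact: test_function_L2.
exists (phi^`())%classic; first exact/test_function_L2/test_function_derive.
exact: weak_derivative_test_function.
Qed.

Lemma H1ZD c f g : H1 a b f -> H1 a b g -> H1 a b (c *: f + g) /\
  L2norm a b (wD a b (c *: f + g)) = L2norm a b (c *: wD a b f + wD a b g).
Proof.
move=> f1 g1; have [Df2 fDf] := wDP f1; have [Dg2 gDg] := wDP g1.
have [f2 g2] := (H1_L2 f1, H1_L2 g1).
apply: H1_weak_derivative; [by apply: L2D => //; exact: L2Z
  |by apply: L2D => //; exact: L2Z|exact: weak_derivativeZD].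
Qed.

Lemma seminormed_H1 : seminormed (H1 a b) (H1norm a b).
Proof.
split.
- exact: H1_cst 0.
- by move=> c f g f1 g1; exact: (H1ZD c f1 g1).1.
- exact: H1norm_ge0.
- move=> f g f1 g1; have := (H1ZD 1 f1 g1).2; rewrite !scale1r => wDfg.
  apply: sqrt_sum_sqr_triangle; rewrite ?L2norm_ge0//.
    by apply: L2normD; exact: H1_L2.
  by rewrite wDfg; apply: L2normD; exact: L2_wD.
- move=> c f f1; have := (H1ZD c f1 (H1_cst 0)).2.
  rewrite (_ : c *: f + cst 0 = c *: f); last by apply/funext => x; rewrite !fctE addr0.
  rewrite /H1norm => ->; rewrite L2normZ ?sqrt_sum_sqrM; last exact: H1_L2.
  suff -> : L2norm a b (c *: wD a b f + wD a b (cst 0)) = `|c| * L2norm a b (wD a b f).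
    exact: sqrt_sum_sqrM.
  have D0 : wD a b (cst 0) = 0 %[ae nu].
    have [Dc2 cDc] := wDP (H1_cst 0).
    exact: (weak_derivative_unique Dc2 (L2_cst _ _ 0) cDc (weak_derivative_cst ab 0)).
  rewrite -L2normZ; last exact: L2_wD.
  have mD : bfun (c *: wD a b f + wD a b (cst 0)).
    apply: (@L2_measurable _ a b); apply: L2D; first exact/L2Z/L2_wD.
    exact/L2_wD/H1_cst.
  apply: (proj2 (L2_ae_eq mD _ _)); first by apply: L2Z; exact: L2_wD.
  by move/ae_eq_forall : D0; apply: filterS => x H _; rewrite !fctE H addr0.
Qed.

Lemma seminormed_H10 : seminormed (H10 a b) (H1norm a b).
Proof.
have DN := seminormed_H1.
have t0 : test_function a b 0.
  split=> [n x|].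
    rewrite (_ : (0^`(n))%classic = cst 0); first exact: derivable_cst.
    elim: n => [|n IH]; first by rewrite derive1n0.
    by rewrite derive1nS IH; apply/funext => y; rewrite derive1_cst.
  by exists set0; split=> //; exact: compact0.
split; [|move=> c f g [f1 f0] [g1 g0]|exact: H1norm_ge0
       |by move=> f g [f1 _] [g1 _]; exact: (seminormD DN)
       |by move=> c f [f1 _]; exact: (seminormZ DN)].
- split; first exact: seminormed0 DN.
  by move=> e e0; exists 0 => //; rewrite subrr (seminorm0 DN).
- split; first exact: (seminormedZD DN).
  move=> e e0.
  have c1 : 0 < `|c| + 1 by rewrite ltr_wpDl.
  have [phi tphi fphi] := f0 (e / 2 / (`|c| + 1)) ltac:(by rewrite !divr_gt0).
  have [psi tpsi gpsi] := g0 (e / 2) ltac:(by rewrite divr_gt0).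
  exists (c *: phi + psi); first exact: test_functionZD.
  have fB := seminormed_sub DN f1 (test_function_H1 tphi).
  have gB := seminormed_sub DN g1 (test_function_H1 tpsi).
  have -> : c *: f + g - (c *: phi + psi) = c *: (f - phi) + (g - psi).
    by rewrite scalerBr opprD addrACA.
  rewrite (le_lt_trans (seminormD DN _ gB))//; first exact: seminormed_scale DN _ _ fB.
  rewrite (seminormZ DN)// (splitr e) ler_ltD//.
  rewrite ltr_pdivlMr// in fphi; rewrite (le_trans _ (ltW fphi))//.
  by rewrite mulrC ler_wpM2l ?H1norm_ge0// lerDl.
Qed.

Lemma seminormed_phase : seminormed (phase a b) (phase_norm a b).
Proof.
have DN2 := seminormed_L2; have DN1 := seminormed_H10.
split=> [|c x y [x1 x2] [y1 y2]|x|x y [x1 x2] [y1 y2]|c x [x1 x2]].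
- by split; [exact: seminormed0 DN2|exact: seminormed0 DN1].
- by split; [exact: (seminormedZD DN2)|exact: (seminormedZD DN1)].
- exact: sqrtr_ge0.
- apply: sqrt_sum_sqr_triangle; rewrite ?L2norm_ge0 ?H1norm_ge0//.
    exact: (seminormD DN2).
  exact: (seminormD DN1).
- by rewrite /phase_norm/= (seminormZ DN2)// (seminormZ DN1)// sqrt_sum_sqrM.
Qed.

End sobolev_seminorms.

(** * Riemann integrals, Gronwall and semigroups *)

Section riemann_integral.
Context {R : realType} {V : lmodType R} (D : set V) (N : V -> R).
Hypothesis DN : seminormed D N.

(** [Psi] plays the part of a primitive of [psi], in the form of a one-sided bound
    on increments: on uniform partitions tagged at left end points, the sum of the
    norms is then bounded by a telescoping sum. *)
Lemma is_integral_sub_le (F G : R -> V) (t : R) (y z : V) (psi Psi : R -> R) :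
  0 <= t ->
  (forall s, 0 <= s <= t -> D (F s)) -> (forall s, 0 <= s <= t -> D (G s)) ->
  (forall s, 0 <= s <= t -> N (F s - G s) <= psi s) ->
  (forall p q, 0 <= p -> p <= q -> q <= t -> (q - p) * psi p <= Psi q - Psi p) ->
  is_integral D N F t y -> is_integral D N G t z ->
  N (y - z) <= Psi t - Psi 0.
Proof.
move=> t0 DF DG FG PsiP [Dy Fy] [Dz Gz].
apply/ler_addgt0Pr => e e0.
have [d d0 dP] := Fy (e / 2) ltac:(by rewrite divr_gt0).
have [d' d'0 d'P] := Gz (e / 2) ltac:(by rewrite divr_gt0).
pose m := Num.min d d'.
have m0 : 0 < m by rewrite lt_min d0 d'0.
have [n nP] : exists n, t / m < n.+1%:R.
  exists (Num.truncn (t / m)); exact: truncnS_gt.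
have n0 : 0 < n.+1%:R :> R by rewrite ltr0n.
pose p i := t * (i%:R / n.+1%:R).
have p0 : p 0%N = 0 by rewrite /p mul0r mulr0.
have pn : p n.+1 = t by rewrite /p divff ?mulr1// gt_eqF.
have pS i : p i.+1 - p i = t / n.+1%:R by rewrite /p -mulrBr -mulrBl -natrB// subSnn mul1r.
have ple i : p i <= p i.+1 by rewrite -subr_ge0 pS divr_ge0// ltW.
have pge0 i : 0 <= p i by rewrite mulr_ge0// divr_ge0// ltW.
have pt i : (i <= n.+1)%N -> p i <= t.
  by move=> le_i; rewrite /p ler_piMr// ler_pdivrMr// mul1r ler_nat.
have small i : p i.+1 - p i < m.
  by rewrite pS ltr_pdivrMr// mulrC -ltr_pdivrMr.
have tagF : forall i, (i < n.+1)%N -> p i <= p i <= p i.+1 /\ p i.+1 - p i < d.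
  by move=> i _; rewrite lexx ple (lt_le_trans (small i))// ge_min lexx.
have tagG : forall i, (i < n.+1)%N -> p i <= p i <= p i.+1 /\ p i.+1 - p i < d'.
  by move=> i _; rewrite lexx ple (lt_le_trans (small i))// ge_min lexx orbT.
have {dP tagF} := dP _ _ _ p0 pn tagF; have {d'P tagG} := d'P _ _ _ p0 pn tagG.
set SG := \sum_(i < _) _ *: G _; set SF := \sum_(i < _) _ *: F _ => SGz SFy.
have DFi i : (i < n.+1)%N -> D ((p i.+1 - p i) *: F (p i)).
  by move=> ni; apply: (seminormed_scale DN); apply: DF; rewrite pge0 pt// ltnW.
have DGi i : (i < n.+1)%N -> D ((p i.+1 - p i) *: G (p i)).
  by move=> ni; apply: (seminormed_scale DN); apply: DG; rewrite pge0 pt// ltnW.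
have DSF : D SF by exact: (seminormed_sum DN DFi).
have DSG : D SG by exact: (seminormed_sum DN DGi).
have SFG : N (SF - SG) <= Psi t - Psi 0.
  have DFGi i : (i < n.+1)%N -> D ((p i.+1 - p i) *: F (p i) - (p i.+1 - p i) *: G (p i)).
    by move=> ni; apply: (seminormed_sub DN); [exact: DFi|exact: DGi].
  rewrite /SF /SG -sumrB (le_trans (seminorm_sum DN DFGi))//.
  have -> : Psi t - Psi 0 = \sum_(i < n.+1) (Psi (p i.+1) - Psi (p i)).
    by rewrite -(big_mkord xpredT (fun i => Psi (p i.+1) - Psi (p i))) telescope_sumr// pn p0.
  apply: ler_sum => i _.
  have pi : 0 <= p i <= t by rewrite pge0 pt// ltnW.
  have DFG : D (F (p i) - G (p i)) by apply: (seminormed_sub DN); [exact: DF|exact: DG].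
  rewrite -scalerBr (seminormZ DN)// ger0_norm ?subr_ge0//.
  rewrite (le_trans _ (PsiP _ _ (pge0 i) (ple i) (pt _ (ltn_ord i))))//.
  by rewrite ler_wpM2l ?subr_ge0// FG.
have := seminorm_triangle DN Dy DSF Dz.
have := seminorm_triangle DN DSF DSG Dz.
rewrite (seminormBC DN Dy DSF); lra.
Qed.

End riemann_integral.

Section gronwall.
Context {R : realType}.

(** Gronwall's inequality as the fixed point of a contraction: the supremum m of
    phi(t) exp(- lam t) satisfies m <= m / 2 + c. *)
Lemma weighted_gronwall (phi : R -> R) (T lam c K : R) : 0 <= lam ->
  (forall s, 0 <= s <= T -> 0 <= phi s <= K) ->
  (forall m, 0 <= m -> (forall s, 0 <= s <= T -> phi s <= m * expR (lam * s)) ->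
     forall t, 0 <= t <= T -> phi t <= (m / 2 + c) * expR (lam * t)) ->
  forall t, 0 <= t <= T -> phi t <= 2 * c * expR (lam * t).
Proof.
move=> lam0 phiK contract t tT.
pose E := [set phi s * expR (- (lam * s)) | s in `[0, T]%classic].
have supE : has_sup E.
  split; first by exists (phi t * expR (- (lam * t))), t => //=; rewrite in_itv.
  exists K => _ [s /= + <-]; rewrite in_itv/= => sT.
  have /andP[ps0 psK] := phiK s sT.
  rewrite (le_trans _ psK)// ler_piMr// -[leRHS]expR0 ler_expR oppr_le0 mulr_ge0//.
  by case/andP: sT.
have ubE s : 0 <= s <= T -> phi s * expR (- (lam * s)) <= sup E.
  by move=> sT; apply: (sup_upper_bound supE); exists s => //=; rewrite in_itv.
have supE0 : 0 <= sup E.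
  by rewrite (le_trans _ (ubE t tT))// mulr_ge0 ?expR_ge0//; case/andP: (phiK t tT).
have phiE s (k : R) : (phi s <= k * expR (lam * s)) = (phi s * expR (- (lam * s)) <= k).
  by rewrite expRN ler_pdivrMr// expR_gt0.
have step s : 0 <= s <= T -> phi s <= (sup E / 2 + c) * expR (lam * s).
  by apply: contract => // u uT; rewrite phiE ubE.
have sup_le : sup E <= sup E / 2 + c.
  apply: ge_sup; first by case: supE.
  by move=> _ [s /= + <-]; rewrite in_itv/= => sT; rewrite -phiE step.
by rewrite phiE (le_trans (ubE t tT))//; lra.
Qed.

End gronwall.

Section semigroup.
Context {R : realType} {V : lmodType R} (D : set V) (N : V -> R).
Variables (S : R -> V -> V) (M0 : R).
Hypothesis DN : seminormed D N.
Hypothesis DNS : C0_semigroup D N S.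
Hypothesis M0E : M0%:E = ereal_sup [set opnorm D N (S t) | t in `[0, +oo[%classic].

(** The operator norm only sees the unit ball.  Vectors of norm zero cannot be
    rescaled and need the boundedness of S(t), which also
    gives S(t) 0 = 0 up to norm zero. *)
Lemma semigroup_le t x : 0 <= t -> D x -> N (S t x) <= M0 * N x.
Proof.
move=> t0 Dx; have D0 := seminormed0 DN.
have DS u : D u -> D (S t u) by exact: semigroup_stable DNS _ _ t0.
have [M SM] := semigroup_bounded DNS t0.
have NS0 : N (S t 0) = 0.
  by apply/eqP; rewrite eq_le (seminorm_ge0 DN) andbT (le_trans (SM _ D0))//
    (seminorm0 DN) mulr0.
have := seminorm_ge0 DN x; rewrite le_eqVlt => /predU1P[Nx0|Nx0].
  by rewrite -Nx0 mulr0 (le_trans (SM _ Dx))// -Nx0 mulr0.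
pose k := (N x)^-1.
have k0 : 0 < k by rewrite invr_gt0.
have Dkx : D (k *: x) by exact: (seminormed_scale DN).
have Skx : N (S t (k *: x)) <= M0.
  rewrite -lee_fin M0E; apply: (@le_trans _ _ (opnorm D N (S t))).
    apply: ereal_sup_ubound; exists (k *: x) => //; split=> //.
    by rewrite (seminormZ DN)// gtr0_norm// mulVf// gt_eqF.
  by apply: ereal_sup_ubound; exists t => //=; rewrite in_itv/= t0.
have lin := semigroup_linear DNS k t0 Dx D0.
rewrite addr0 in lin.
have kSx : N (k *: S t x) <= N (S t (k *: x)).
  have DkS : D (k *: S t x) by apply: (seminormed_scale DN); exact: DS.
  have DkS0 : D (k *: S t x + S t 0) by apply: (seminormed_add DN) => //; exact: DS.
  have -> : k *: S t x = (k *: S t x + S t 0 - S t (k *: x)) - S t 0 + S t (k *: x).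
    by rewrite [RHS]addrAC subrK addrK.
  have Ddiff : D (k *: S t x + S t 0 - S t (k *: x)).
    by apply: (seminormed_sub DN) => //; exact: DS.
  have := seminormD DN (seminormed_sub DN Ddiff (DS _ D0)) (DS _ Dkx).
  have := seminormB DN Ddiff (DS _ D0).
  rewrite NS0 (seminormBC DN DkS0 (DS _ Dkx)) lin; lra.
rewrite (seminormZ DN) in kSx; last exact: DS.
rewrite gtr0_norm// in kSx.
have := le_trans kSx Skx.
by rewrite mulrC ler_pdivrMr.
Qed.

Lemma semigroup_lipschitz t x y : 0 <= t -> D x -> D y ->
  N (S t x - S t y) <= M0 * N (x - y).
Proof.
move=> t0 Dx Dy.
have DS u : D u -> D (S t u) by exact: semigroup_stable DNS _ _ t0.
have Dxy := seminormed_sub DN Dx Dy.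
have := semigroup_linear DNS (-1) t0 Dy Dx.
rewrite !scaleN1r ![- _ + _]addrC => lin.
rewrite (le_trans _ (semigroup_le t0 Dxy))//.
rewrite -[X in N X <= _](subrK (S t (x - y))).
have DSB : D (S t x - S t y) by apply: (seminormed_sub DN); exact: DS.
have := seminormD DN (seminormed_sub DN DSB (DS _ Dxy)) (DS _ Dxy).
by rewrite (seminormBC DN DSB (DS _ Dxy)) lin add0r.
Qed.

(** Gronwall with lam = 2 M A: the weight then absorbs the feedback A |z - z'|
    with a factor 1 / 2. *)
Lemma mild_solution_stability (z0 : V) (z z' f f' : R -> V) (T M A B K : R) :
  0 <= T -> M0 <= M -> 0 < M -> 0 < A -> 0 <= B -> D z0 ->
  (forall t, 0 <= t <= T -> D (z t)) -> (forall t, 0 <= t <= T -> D (z' t)) ->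
  (forall t, 0 <= t <= T -> D (f t)) -> (forall t, 0 <= t <= T -> D (f' t)) ->
  (forall t, 0 <= t <= T -> exists y,
     is_integral D N (fun s => S (t - s) (f s)) t y /\ N (z t - (S t z0 + y)) = 0) ->
  (forall t, 0 <= t <= T -> exists y,
     is_integral D N (fun s => S (t - s) (f' s)) t y /\ N (z' t - (S t z0 + y)) = 0) ->
  (forall t, 0 <= t <= T -> N (z t - z' t) <= K) ->
  (forall t, 0 <= t <= T -> N (f t - f' t) <= A * N (z t - z' t) + B) ->
  forall t, 0 <= t <= T -> N (z t - z' t) <= 2 * (M * B * T) * expR (2 * M * A * T).
Proof.
move=> T0 M0M Mgt0 A0 B0 Dz0 Dz Dz' Df Df' zP z'P zK ff' t tT.
have lam0 : 0 < 2 * M * A by rewrite !mulr_gt0.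
have MBT : 0 <= M * B * T by rewrite !mulr_ge0// ltW.
suff : N (z t - z' t) <= 2 * (M * B * T) * expR (2 * M * A * t).
  move=> /le_trans; apply; apply: ler_wpM2l; first exact: mulr_ge0.
  by rewrite ler_expR; apply: ler_wpM2l; [exact: ltW|case/andP: tT].
apply: (@weighted_gronwall _ (fun t => N (z t - z' t)) T _ _ K) => //; first exact: ltW.
  by move=> s sT; rewrite (seminorm_ge0 DN) zK.
move=> m m0 mP {tT}t /andP[t0 tT].
have tT' : 0 <= t <= T by rewrite t0 tT.
have sub s : 0 <= s <= t -> 0 <= s <= T by move=> /andP[-> st]; exact: le_trans tT.
have [y [yint zy]] := zP _ tT'; have [y' [y'int z'y']] := z'P _ tT'.
have [Dy Dy'] := (proj1 yint, proj1 y'int).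
have DSz0 : D (S t z0) by exact: semigroup_stable DNS _ _ t0 Dz0.
have yy' : N (y - y') <=
    (m / 2 * expR (2 * M * A * t) + M * B * t) - (m / 2 * expR (2 * M * A * 0) + M * B * 0).
  (* [Psi] is the primitive of [psi]; (m / 2) (2 M A) = M A m is where the factor 2
     in the exponent comes from. *)
  pose Psi (s : R) := m / 2 * expR (2 * M * A * s) + M * B * s.
  pose psi (s : R) := M * (A * (m * expR (2 * M * A * s)) + B).
  apply: (@is_integral_sub_le _ _ D N DN _ _ t y y' psi Psi t0 _ _ _ _ yint y'int).
  - move=> s st; apply: (semigroup_stable DNS); last exact/Df/sub.
    by rewrite subr_ge0; case/andP: st.
  - move=> s st; apply: (semigroup_stable DNS); last exact/Df'/sub.
    by rewrite subr_ge0; case/andP: st.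
  - move=> s st; have sT := sub s st.
    have ts0 : 0 <= t - s by rewrite subr_ge0; case/andP: st.
    rewrite (le_trans (semigroup_lipschitz ts0 (Df _ sT) (Df' _ sT)))//.
    rewrite (le_trans (ler_wpM2r (seminorm_ge0 DN _) M0M))//.
    apply: ler_wpM2l; first exact: ltW.
    by rewrite (le_trans (ff' _ sT))// lerD2r; apply: ler_wpM2l; [exact: ltW|exact: mP].
  - move=> p q p0 pq qt; rewrite /psi /Psi.
    have := expR_ge1Dx (2 * M * A * (q - p)).
    have -> : expR (2 * M * A * q) = expR (2 * M * A * p) * expR (2 * M * A * (q - p)).
      by rewrite -expRD; congr expR; ring.
    set E := expR (2 * M * A * p); set F := expR (2 * M * A * (q - p)) => EF.
    have E0 : 0 <= E by exact: expR_ge0.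
    have : m / 2 * E * (2 * M * A * (q - p)) <= m / 2 * E * (F - 1).
      by rewrite ler_wpM2l// ?mulr_ge0//; lra.
    lra.
have zz' : N (z t - z' t) <= N (y - y').
  have Dw : D (z t - (S t z0 + y)).
    by apply: (seminormed_sub DN); [exact: Dz|exact: (seminormed_add DN)].
  have Dw' : D (z' t - (S t z0 + y')).
    by apply: (seminormed_sub DN); [exact: Dz'|exact: (seminormed_add DN)].
  have -> : z t - z' t =
      (z t - (S t z0 + y)) - (z' t - (S t z0 + y')) + (y - y').
    have -> : y - y' = (S t z0 + y) - (S t z0 + y').
      by rewrite opprD addrACA subrr add0r.
    by rewrite opprB addrAC !subrKA.
  rewrite (le_trans (seminormD DN _ _))//; [exact: (seminormed_sub DN)|exact: (seminormed_sub DN)|].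
  by rewrite -[leRHS]add0r lerD2r (le_trans (seminormB DN Dw Dw'))// zy z'y' addr0.
rewrite (le_trans zz')// (le_trans yy')// !mulr0 expR0 mulr1 addr0.
have e1 : 1 <= expR (2 * M * A * t) by rewrite -[leLHS]expR0 ler_expR mulr_ge0// ltW.
have MBt : M * B * t <= M * B * T by rewrite ler_wpM2l// mulr_ge0// ltW.
have : M * B * T <= M * B * T * expR (2 * M * A * t) by rewrite ler_peMr.
by lra.
Qed.

End semigroup.

(** * The nonlinearity on functions bounded below *)

Section nonlinearity.
Context {R : realType}.
Variables (a b : R).
Implicit Types f g v w : R -> R.
Local Notation nu := (leb_itv a b).

Lemma invr_half_le (k x : R) : 0 < k -> k / 2 <= x -> `|x^-1| <= 2 / k.
Proof.
move=> k0 kx; have x0 : 0 < x by rewrite (lt_le_trans _ kx)// divr_gt0.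
by rewrite gtr0_norm ?invr_gt0// -invf_div lef_pV2// posrE// divr_gt0.
Qed.

Lemma invr_lipschitz (k x y : R) : 0 < k -> k / 2 <= x -> k / 2 <= y ->
  `|x^-1 - y^-1| <= 4 / k ^+ 2 * `|x - y|.
Proof.
move=> k0 kx ky.
have k20 : 0 < k / 2 by rewrite divr_gt0.
have x0 : x != 0 by rewrite gt_eqF// (lt_le_trans k20 kx).
have y0 : y != 0 by rewrite gt_eqF// (lt_le_trans k20 ky).
have -> : x^-1 - y^-1 = x^-1 * y^-1 * (y - x) by field; rewrite x0 y0.
rewrite !normrM distrC ler_wpM2r//.
have -> : 4 / k ^+ 2 = 2 / k * (2 / k) by field; rewrite gt_eqF.
by rewrite ler_pM// invr_half_le.
Qed.

Lemma invr_sqr_lipschitz (k x y : R) : 0 < k -> k / 2 <= x -> k / 2 <= y ->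
  `|x ^- 2 - y ^- 2| <= 16 / k ^+ 3 * `|x - y|.
Proof.
move=> k0 kx ky; rewrite -(exprVn x) -(exprVn y) subr_sqr normrM.
have -> : 16 / k ^+ 3 * `|x - y| = 4 / k ^+ 2 * `|x - y| * (2 / k + 2 / k).
  by field; rewrite gt_eqF.
rewrite ler_pM// ?invr_lipschitz// (le_trans (ler_normD _ _))//.
by rewrite lerD// invr_half_le.
Qed.

(** Away from zero 1 / y = y (y^2)^(-1), and real powers are measurable; at zero
    both sides vanish. *)
Lemma bfun_inv f : bfun f -> bfun (fun x => (f x)^-1).
Proof.
move=> mf.
have -> : (fun x => (f x)^-1) = (fun x => f x * (f x ^+ 2) `^ (-1)).
  apply/funext => x; rewrite powR_inv1 ?sqr_ge0//.
  by have [->|fx0] := eqVneq (f x) 0; [rewrite invr0 mul0r|field].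
apply: measurable_funM => //.
by apply: (measurableT_comp (measurable_powR _)); exact: measurable_funX.
Qed.

Section bounded_below.
Variables (k th : R) (w w' : R -> R).
Hypotheses (k0 : 0 < k) (w2 : L2 a b w) (w'2 : L2 a b w').
Hypotheses (kw : \forall x \ae nu, k / 2 <= w x + th)
  (kw' : \forall x \ae nu, k / 2 <= w' x + th).

Let bfunD f : L2 a b f -> bfun (fun x => f x + th).
Proof. by move=> f2; apply: measurable_funD => //; exact: L2_measurable f2. Qed.

Lemma L2_invr_sqr : L2 a b (fun x => (w x + th) ^- 2).
Proof.
have c0 : 0 <= (2 / k) ^+ 2 by rewrite sqr_ge0.
have m : bfun (fun x => (w x + th) ^- 2).
  by apply: bfun_inv; apply: measurable_funX; exact: bfunD.
apply: (proj1 (L2_ae_le c0 m (L2_cst a b 1) _)).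
apply: filterS kw => x kx; rewrite normr1 mulr1 -exprVn normrX.
by rewrite ler_pXn2r// ?nnegrE ?divr_ge0 ?(ltW k0)// invr_half_le.
Qed.

Lemma L2norm_invr_sqr_sub :
  L2norm a b ((fun x => (w x + th) ^- 2) - (fun x => (w' x + th) ^- 2)) <=
  16 / k ^+ 3 * L2norm a b (w - w').
Proof.
have c0 : 0 <= 16 / k ^+ 3 by rewrite divr_ge0// exprn_ge0// ltW.
have m f : L2 a b f -> bfun (fun x => (f x + th) ^- 2).
  by move=> f2; apply: bfun_inv; apply: measurable_funX; exact: bfunD.
apply: (proj2 (L2_ae_le c0 _ _ _)).
- by apply: measurable_funB; exact: m.
- exact: L2B.
- apply: filterS2 kw kw' => x kx k'x; rewrite !fctE.
  rewrite (le_trans (invr_sqr_lipschitz k0 kx k'x))//.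
  by rewrite opprD addrACA subrr addr0.
Qed.

Lemma L2_quotient v : L2 a b v -> L2 a b (fun x => v x / (w x + th)).
Proof.
move=> v2; have c0 : 0 <= 2 / k by rewrite divr_ge0// ltW.
have m : bfun (fun x => v x / (w x + th)).
  apply: measurable_funM; [exact: L2_measurable v2|].
  by apply: bfun_inv; exact: bfunD.
apply: (proj1 (L2_ae_le c0 m v2 _)).
by apply: filterS kw => x kx; rewrite normrM mulrC ler_wpM2r// invr_half_le.
Qed.

(** The bound [s] is uniform because a product of two square-integrable functions
    need not be square-integrable. *)
Lemma L2norm_quotient_sub v v' s : 0 <= s -> L2 a b v -> L2 a b v' ->
  (\forall x \ae nu, `|w x - w' x| <= s) ->
  L2norm a b ((fun x => v x / (w x + th)) - (fun x => v' x / (w' x + th))) <=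
  2 / k * L2norm a b (v - v') + 4 / k ^+ 2 * s * L2norm a b v'.
Proof.
move=> s0 v2 v'2 ww'.
have c0 : 0 <= 2 / k by rewrite divr_ge0// ltW.
have c1 : 0 <= 4 / k ^+ 2 * s by rewrite mulr_ge0// divr_ge0// exprn_ge0// ltW.
pose p : R -> R := fun x => (v - v') x / (w x + th).
pose q : R -> R := fun x => v' x * ((w x + th)^-1 - (w' x + th)^-1).
have -> : (fun x => v x / (w x + th)) - (fun x => v' x / (w' x + th)) = p + q.
  by apply/funext => x; rewrite /p /q !fctE; ring.
have mV f : L2 a b f -> bfun (fun x => (f x + th)^-1).
  by move=> f2; apply: bfun_inv; exact: bfunD.
have mp : bfun p by apply: measurable_funM; [apply: (@L2_measurable _ a b); exact: L2B|exact: mV].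
have mq : bfun q.
  by apply: measurable_funM; [exact: L2_measurable v'2|apply: measurable_funB; exact: mV].
have [p2 ple] := L2_ae_le c0 mp (L2B v2 v'2) ltac:(
  by apply: filterS kw => x kx; rewrite normrM mulrC ler_wpM2r// invr_half_le).
have [q2 qle] := L2_ae_le c1 mq v'2 ltac:(
  by apply: filterS3 kw kw' ww' => x kx k'x ws; rewrite normrM mulrC ler_wpM2r//;
     rewrite (le_trans (invr_lipschitz k0 kx k'x))//;
     rewrite ler_wpM2l ?divr_ge0 ?exprn_ge0 ?(ltW k0)//;
     rewrite opprD addrACA subrr addr0).
by rewrite (le_trans (L2normD p2 q2))// lerD.
Qed.

End bounded_below.

(** Depends on the interval only, so that an element can be chosen independently
    of the other data. *)
Definition sobolev_constant : set R := [set C | 0 < C /\ forall f, H1 a b f ->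
  ('N[nu]_+oo[EFin \o f] <= (C * H1norm a b f)%:E)%E].

Hypothesis ab : a < b.

Lemma leb_itv_gt0 : (0 < nu setT)%E.
Proof. by rewrite leb_itv_setT lebesgue_measure_itv /= lte_fin ab -EFinB lte_fin subr_gt0. Qed.

Lemma sobolev_constant_ae C f : sobolev_constant C -> H1 a b f ->
  \forall x \ae nu, `|f x| <= C * H1norm a b f.
Proof.
move=> [C0 CP] f1; have := CP f f1.
rewrite unlock leb_itv_gt0 => /ess_supP.
by apply: filterS => x /=; rewrite lee_fin.
Qed.

(** w stays within C r < kappa / 2 of w0 - th2 in the supremum norm, and
    w0 >= kappa. *)
Lemma H1_lower_bound C r k th w w0 : sobolev_constant C -> H1 a b w -> H1 a b w0 ->
  ess_inf nu (EFin \o w0) = k%:E -> r < k / (2 * C) ->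
  H1norm a b (w - (fun x => w0 x - th)) <= r ->
  \forall x \ae nu, k / 2 <= w x + th.
Proof.
move=> CC w1 w01 w0k rk wr; have [C0 _] := CC.
have H1DN := seminormed_H1 ab.
have d1 : H1 a b (w - (fun x => w0 x - th)).
  apply: (seminormed_sub H1DN) => //.
  exact: (seminormed_sub H1DN w01 (H1_cst ab th)).
have := ess_inf_le nu (EFin \o w0); rewrite w0k.
have := sobolev_constant_ae CC d1.
apply: filterS2 => x wx; rewrite /= lee_fin => kx.
have Cr : C * H1norm a b (w - (fun x => w0 x - th)) <= k / 2.
  rewrite (le_trans (ler_wpM2l (ltW C0) wr))// mulrC -ler_pdivlMr//.
  by rewrite (le_trans (ltW rk))// invfM mulrA.
have := le_trans wx Cr; rewrite !fctE ler_norml => /andP[+ _].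
lra.
Qed.

(** Makes |w0|_H1 control the radius r < kappa / (2 C) without reference to C. *)
Lemma le_sobolev_H1norm C k w0 : sobolev_constant C -> H1 a b w0 ->
  ess_inf nu (EFin \o w0) = k%:E -> k <= C * H1norm a b w0.
Proof.
move=> CC w01 w0k.
have pf : ProperFilter (almost_everywhere nu).
  by apply: ae_properfilter_algebraOfSetsType; exact: leb_itv_gt0.
have kw0 := ess_inf_le nu (EFin \o w0); rewrite w0k in kw0.
have [x [kx]] := filter_ex (filterI kw0 (sobolev_constant_ae CC w01)).
move=> wx; rewrite /= lee_fin in kx.
by rewrite (le_trans kx)// (le_trans (ler_norm _) wx).
Qed.

(** [H10] contains every [H1] representative of its elements.  Applied to the initial
    condition of a solution, this replaces a description of [H10] by traces. *)
Lemma H10_closed f g : H10 a b f -> H1 a b g -> H1norm a b (f - g) = 0 -> H10 a b g.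
Proof.
move=> [f1 f0] g1 fg; split=> // e e0; have [phi tphi fphi] := f0 e e0.
exists phi => //; have H1DN := seminormed_H1 ab.
rewrite (le_lt_trans (seminorm_triangle H1DN g1 f1 (test_function_H1 ab tphi)))//.
by rewrite (seminormBC H1DN g1 f1) fg add0r.
Qed.

End nonlinearity.

Section sup_norm_comparison.
Context {R : realType} {V1 V2 : lmodType R}.

(** [0 < L] matters when the supremum on the right is infinite, since 0 * +oo = 0. *)
Lemma sup_norm_le_mul (N1 : V1 -> R) (N2 : V2 -> R) (T L : R)
    (u : R -> V1) (w : R -> V2) :
  0 <= T -> 0 < L -> (forall x, 0 <= N1 x) ->
  (forall d, 0 <= d -> (forall t, 0 <= t <= T -> N1 (u t) <= d) ->
     forall t, 0 <= t <= T -> N2 (w t) <= L * d) ->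
  (sup_norm N2 T w <= L%:E * sup_norm N1 T u)%E.
Proof.
move=> T0 L0 N10 H.
have ub t : 0 <= t <= T -> ((N1 (u t))%:E <= sup_norm N1 T u)%E.
  by move=> tT; apply: ereal_sup_ubound; exists t => //=; rewrite in_itv.
have T00 : 0 <= (0 : R) <= T by rewrite lexx.
have : (0 <= sup_norm N1 T u)%E by rewrite (le_trans _ (ub _ T00))// lee_fin.
case: (sup_norm N1 T u) ub => [d| |//] ub d0; last by rewrite gt0_muley ?leey// lte_fin.
apply: ge_ereal_sup => _ [t /= + <-]; rewrite in_itv/= => tT.
by rewrite -EFinM lee_fin; apply: H.
Qed.

Lemma sup_norm_le (N : V1 -> R) (T c : R) (u : R -> V1) t :
  (sup_norm N T u <= c%:E)%E -> 0 <= t <= T -> N (u t) <= c.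
Proof.
move=> H tT; rewrite -lee_fin (le_trans _ H)//.
by apply: ereal_sup_ubound; exists t => //=; rewrite in_itv.
Qed.

End sup_norm_comparison.

(** * The solution operators *)

Section solution_operators.
Context {R : realType}.
Variables (a b bF bp th1 th2 kappa C r M0 : R) (u0t v0 w0 : R -> R).
Variable S : R -> (R -> R) * (R -> R) -> (R -> R) * (R -> R).
Local Notation nu := (leb_itv a b).
Local Notation X := (phase a b).
Local Notation NX := (phase_norm a b).
Local Notation z0 := ((v0, fun x => w0 x - th2) : (R -> R) * (R -> R)).
Local Notation CB := (C0T (H2ball a b u0t r) (H2norm a b)).
Local Notation Z := (Zspace a b r z0).
Local Notation mild := (mild_solution a b bF bp th1 th2 S z0).
Local Notation forcing u z := (fun s : R =>
  (Gop bF bp th1 th2 (fun s' => (z s').2) s + bp *: u s, 0) : (R -> R) * (R -> R)).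
Implicit Types (u : R -> R -> R) (z : R -> (R -> R) * (R -> R)) (T t : R).

Hypotheses (ab : a < b) (bF0 : 0 < bF) (bp0 : 0 < bp) (kappa0 : 0 < kappa).
Hypotheses (v02 : L2 a b v0) (w01 : H1 a b w0).
Hypothesis w0k : ess_inf nu (EFin \o w0) = kappa%:E.
Hypothesis CC : sobolev_constant a b C.
Hypothesis rk : r < kappa / (2 * C).

Lemma L2norm_fst_le_phase (y : (R -> R) * (R -> R)) : L2norm a b y.1 <= NX y.
Proof. by apply: le_sqrt_sum_sqrl; exact: L2norm_ge0. Qed.

Lemma H1norm_snd_le_phase (y : (R -> R) * (R -> R)) : H1norm a b y.2 <= NX y.
Proof. by apply: le_sqrt_sum_sqrr; exact: H1norm_ge0. Qed.

Lemma phase_norm_inl f : NX (f, 0) = L2norm a b f.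
Proof.
rewrite /phase_norm/= (seminorm0 (seminormed_H1 ab)) expr0n addr0 sqrtr_sqr.
by rewrite ger0_norm// L2norm_ge0.
Qed.

Lemma w0t_H1 : H1 a b (fun x => w0 x - th2).
Proof. exact: (seminormed_sub (seminormed_H1 ab) w01 (H1_cst ab th2)). Qed.

Lemma Zspace_phase T z t : Z T z -> 0 <= t <= T -> X (z t).
Proof. by move=> [[Xz _] _ _]; exact: Xz. Qed.

Lemma Zspace_near T z t : Z T z -> 0 <= t <= T -> NX (z t - z0) <= r.
Proof. by move=> [_ _]; exact: sup_norm_le. Qed.

(** z 0 lies in the phase space and represents the same element as [z0]. *)
Lemma Zspace_initial T z : 0 <= T -> Z T z -> X z0.
Proof.
move=> T0 Zz; split=> //.
have [_ z00] := Zspace_phase Zz (ltac:(by rewrite lexx T0) : 0 <= 0 <= T).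
apply: (H10_closed ab z00); first exact: w0t_H1.
have [_ zz0 _] := Zz; have := H1norm_snd_le_phase (z 0 - z0).
by rewrite zz0 => le0; apply/eqP; rewrite eq_le H1norm_ge0 andbT.
Qed.

Lemma Zspace_lower_bound T z t : Z T z -> 0 <= t <= T ->
  \forall x \ae nu, kappa / 2 <= (z t).2 x + th2.
Proof.
move=> Zz tT; have [_ [z1 _]] := Zspace_phase Zz tT.
apply: (H1_lower_bound ab CC z1 w01 w0k rk).
exact: (le_trans (H1norm_snd_le_phase (z t - z0)) (Zspace_near Zz tT)).
Qed.

Lemma forcing_phase T u z t : CB T u -> Z T z -> 0 <= t <= T -> X (forcing u z t).
Proof.
move=> [Bu _] Zz tT; split; last exact: (seminormed0 (seminormed_H10 ab)).
have [_ [z1 _]] := Zspace_phase Zz tT.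
have [[[u2 _] _] _ _] := Bu t tT.
apply: L2D; last exact: L2Z.
have I2 := L2_invr_sqr kappa0 (H1_L2 z1) (Zspace_lower_bound Zz tT).
exact: (L2D (L2Z (- bF) I2) (L2_cst a b (bp * (th1 - 1)))).
Qed.

Lemma forcing_lipschitz T u u' z z' t : CB T u -> CB T u' -> Z T z -> Z T z' ->
  0 <= t <= T ->
  NX (forcing u z t - forcing u' z' t) <=
  bF * (16 / kappa ^+ 3) * NX (z t - z' t) + bp * H2norm a b (u t - u' t).
Proof.
move=> [Bu _] [Bu' _] Zz Zz' tT.
have [_ [z1 _]] := Zspace_phase Zz tT; have [_ [z'1 _]] := Zspace_phase Zz' tT.
have [[[u2 _] _] _ _] := Bu t tT; have [[[u'2 _] _] _ _] := Bu' t tT.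
have lb := Zspace_lower_bound Zz tT; have lb' := Zspace_lower_bound Zz' tT.
have [z2 z'2] := (H1_L2 z1, H1_L2 z'1).
have I2 := L2_invr_sqr kappa0 z2 lb; have I'2 := L2_invr_sqr kappa0 z'2 lb'.
set I := (fun x => _) in I2; set I' := (fun x => _) in I'2.
have -> : forcing u z t - forcing u' z' t =
    ((- bF) *: (I - I') + bp *: (u t - u' t), 0).
  congr pair; last exact: subrr.
  apply/funext => x; rewrite /I /I' /Gop !fctE /GRing.scale/=.
  rewrite -[X in _ + X = _]/(- (- bF / ((z' t).2 x + th2) ^+ 2 +
    bp * (th1 - 1) + bp * u' t x)).
  by ring.
rewrite phase_norm_inl (le_trans (L2normD _ _))//; [exact/L2Z/L2B|exact/L2Z/L2B|].
rewrite !L2normZ; [|exact: L2B|exact: L2B].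
rewrite normrN !gtr0_norm// lerD//.
  rewrite -mulrA ler_pM2l// (le_trans (L2norm_invr_sqr_sub kappa0 z2 z'2 lb lb'))//.
  rewrite ler_wpM2l ?divr_ge0 ?exprn_ge0 ?(ltW kappa0)//.
  rewrite (le_trans (L2norm_le_H1norm _ _ _))//.
  exact: (H1norm_snd_le_phase (z t - z' t)).
by rewrite ler_pM2l// L2norm_le_H2norm.
Qed.

(** Both solutions start from [z0] and stay within r of it, which provides the
    a priori bound 2 r needed for Gronwall. *)
Lemma wave_solution_lipschitz T u u' z z' (d : R) :
  C0_semigroup X NX S ->
  M0%:E = ereal_sup [set opnorm X NX (S t) | t in `[0, +oo[%classic] ->
  0 <= T -> CB T u -> CB T u' -> Z T z -> mild T u z -> Z T z' -> mild T u' z' ->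
  0 <= d -> (forall t, 0 <= t <= T -> H2norm a b (u t - u' t) <= d) ->
  forall t, 0 <= t <= T -> NX (z t - z' t) <=
    2 * ((`|M0| + 1) * bp * T) * expR (2 * (`|M0| + 1) * (bF * (16 / kappa ^+ 3)) * T) * d.
Proof.
move=> SX M0E T0 Bu Bu' Zz mz Zz' mz' d0 ud t tT.
have XN := seminormed_phase ab.
have Xz0 := Zspace_initial T0 Zz.
have M1 : 0 < `|M0| + 1 by rewrite ltr_wpDl.
have A0 : 0 < bF * (16 / kappa ^+ 3) by rewrite mulr_gt0// divr_gt0// exprn_gt0.
have M0M : M0 <= `|M0| + 1 by rewrite (le_trans (ler_norm _))// lerDl.
have bpd : 0 <= bp * d by rewrite mulr_ge0// ltW.
have zz' s : 0 <= s <= T -> NX (z s - z' s) <= r + r.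
  move=> sT.
  rewrite (le_trans (seminorm_triangle XN (Zspace_phase Zz sT) Xz0 (Zspace_phase Zz' sT)))//.
  rewrite lerD ?(Zspace_near Zz)// (seminormBC XN Xz0 (Zspace_phase Zz' sT)).
  exact: (Zspace_near Zz').
have ff' s : 0 <= s <= T -> NX (forcing u z s - forcing u' z' s) <=
    bF * (16 / kappa ^+ 3) * NX (z s - z' s) + bp * d.
  move=> sT; rewrite (le_trans (forcing_lipschitz Bu Bu' Zz Zz' sT))//.
  by rewrite lerD2l ler_pM2l// ud.
have := mild_solution_stability XN SX M0E T0 M0M M1 A0 bpd Xz0
  (fun s => @Zspace_phase T z s Zz) (fun s => @Zspace_phase T z' s Zz')
  (fun s => @forcing_phase T u z s Bu Zz) (fun s => @forcing_phase T u' z' s Bu' Zz')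
  mz mz' zz' ff' tT.
by congr (_ <= _); ring.
Qed.

(** Allowing two times and two solutions covers both the continuity of t |-> v / W
    and the Lipschitz dependence on u. *)
Lemma quotient_lipschitz T z z' t t' (B : R) : Z T z -> Z T z' ->
  0 <= t <= T -> 0 <= t' <= T -> sobolev_constant a b B ->
  L2norm a b ((fun x => (z t).1 x / ((z t).2 x + th2)) -
              (fun x => (z' t').1 x / ((z' t').2 x + th2))) <=
  (2 / kappa + 4 / kappa ^+ 2 * (B * L2norm a b (z' t').1)) * NX (z t - z' t').
Proof.
move=> Zz Zz' tT t'T BB; have [B0 _] := BB.
have [v2 [z1 _]] := Zspace_phase Zz tT; have [v'2 [z'1 _]] := Zspace_phase Zz' t'T.
have lb := Zspace_lower_bound Zz tT; have lb' := Zspace_lower_bound Zz' t'T.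
have ww' := sobolev_constant_ae ab BB (seminormed_sub (seminormed_H1 ab) z1 z'1).
have s0 : 0 <= B * H1norm a b ((z t).2 - (z' t').2) by rewrite mulr_ge0 ?H1norm_ge0// ltW.
rewrite (le_trans (L2norm_quotient_sub kappa0 (H1_L2 z1) (H1_L2 z'1) lb lb' s0 v2 v'2 ww'))//.
rewrite [leRHS]mulrDl lerD//.
  rewrite ler_pM2l ?divr_gt0//; exact: (L2norm_fst_le_phase (z t - z' t')).
have le1 := H1norm_snd_le_phase (z t - z' t').
have -> : 4 / kappa ^+ 2 * (B * H1norm a b ((z t).2 - (z' t').2)) * L2norm a b (z' t').1 =
  4 / kappa ^+ 2 * (B * L2norm a b (z' t').1) * H1norm a b ((z t).2 - (z' t').2) by ring.
rewrite ler_wpM2l// mulr_ge0//; first by rewrite divr_ge0// exprn_ge0// ltW.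
by rewrite mulr_ge0 ?L2norm_ge0// ltW.
Qed.

Lemma quotient_C0T T z : Z T z ->
  C0T (L2 a b) (L2norm a b) T (fun t x => (z t).1 x / ((z t).2 x + th2)).
Proof.
move=> Zz; split=> t tT.
  have [v2 [z1 _]] := Zspace_phase Zz tT.
  exact: (L2_quotient kappa0 (H1_L2 z1) (Zspace_lower_bound Zz tT) v2).
have [[_ zc] _ _] := Zz.
set K := 2 / kappa + 4 / kappa ^+ 2 * (C * L2norm a b (z t).1).
have lim0 : K * NX (z s - z t) @[s --> within `[0, T] (nbhs t)] --> (0 : R).
  by rewrite -[X in _ --> X](mulr0 K); apply: cvgMr; exact: zc.
apply: squeeze_cvgr lim0; last exact: (cvg_cst (0 : R)).
apply: filterS (withinT _ _) => s /=; rewrite in_itv/= => sT.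
by rewrite L2norm_ge0; exact: (quotient_lipschitz Zz Zz sT tT CC).
Qed.

End solution_operators.


Theorem theorem4p1 (R : realType) :
  exists (LW : forall T0 M0 kappa w0_H1 a b bp bF : R, R)
         (LW2 : forall LW_value v0_L2 T0 M0 kappa w0_H1 a b bp bF : R, R),
  forall (a b bF bp th1 th2 sigma kappa C r M0 T0 : R) (u0 v0 w0 : R -> R)
    (S : R -> (R -> R) * (R -> R) -> (R -> R) * (R -> R)),
  let X := phase a b in
  let NX := phase_norm a b in
  let u0t : R -> R := fun x => u0 x - th1 in
  let z0 : (R -> R) * (R -> R) := (v0, fun x => w0 x - th2) in
  let CB := C0T (H2ball a b u0t r) (H2norm a b) in
  let Z := Zspace a b r z0 in
  let mild := mild_solution a b bF bp th1 th2 S z0 in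
  let lw := LW T0 M0 kappa (H1norm a b w0) a b bp bF in
  let lw2 := LW2 lw (L2norm a b v0) T0 M0 kappa (H1norm a b w0) a b bp bF in
  a < b ->
  0 < bF -> 0 < bp -> 0 < th1 -> 0 < th2 ->
  0 < sigma < 1 / 2 ->
  H2plus a b sigma u0 -> H10 a b v0 -> H2 a b w0 ->
  boundary_eq a b u0 (cst th1) -> boundary_eq a b w0 (cst th2) ->
  ess_inf (leb_itv a b) (EFin \o w0) = kappa%:E -> 0 < kappa ->
  0 < C ->
  (forall f, H1 a b f ->
     ('N[leb_itv a b]_+oo [EFin \o f] <= (C * H1norm a b f)%:E)%E) ->
  0 < r < kappa / (2 * C) ->
  C0_semigroup X NX S -> is_generator X NX S (wave_operator a b) ->
  M0%:E = ereal_sup [set opnorm X NX (S t) | t in `[0, +oo[] ->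
  0 < T0 ->
  (forall T, 0 < T < T0 -> forall u, CB T u ->
     (exists z, Z T z /\ mild T u z) /\
     (forall z z', Z T z /\ mild T u z -> Z T z' /\ mild T u z' ->
        forall t, 0 <= t <= T -> NX (z t - z' t) = 0)) ->
  forall T, 0 < T < T0 ->
  let w1 := W1 a b bF bp th1 th2 r S z0 T in
  let w2 := W2 a b bF bp th1 th2 r S z0 T in
  [/\ forall u, CB T u -> Z T (w1 u) /\ mild T u (w1 u),
      forall u u', CB T u -> CB T u' ->
        (sup_norm NX T (fun t => (w1 u t - w1 u' t)%R)
         <= lw%:E * sup_norm (H2norm a b) T (fun t => (u t - u' t)%R))%E,
      forall u, CB T u -> C0T (L2 a b) (L2norm a b) T (w2 u) &
      forall u u', CB T u -> CB T u' ->
        (sup_norm (L2norm a b) T (fun t => (w2 u t - w2 u' t)%R)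
         <= lw2%:E * sup_norm (H2norm a b) T (fun t => (u t - u' t)%R))%E].
Proof.
(* |M0| + 1 rather than M0 makes the constant positive, as [sup_norm_le_mul]
   requires. *)
exists (fun T0 M0 kappa _ _ _ bp bF => 2 * ((`|M0| + 1) * bp * T0) *
          expR (2 * (`|M0| + 1) * (bF * (16 / kappa ^+ 3)) * T0)).
exists (fun lw v0_L2 _ _ kappa w0_H1 a b _ _ =>
          (2 / kappa + 4 / kappa ^+ 2 *
             (xget 0 (sobolev_constant a b) * (v0_L2 + w0_H1))) * lw).
move=> a b bF bp th1 th2 sigma kappa C r M0 T0 u0 v0 w0 S X NX u0t z0 CB Z mild lw lw2.
move=> ab bF0 bp0 _ _ _ _ v01 [w01 _] _ _ w0k kappa0 C0 CP /andP[r0 rk] SX _ M0E T00.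
move=> exist_sol T /andP[T_gt0 TT0] w1 w2.
have CC : sobolev_constant a b C by [].
have v02 : L2 a b v0 := H1_L2 v01.1.
have T0' : 0 <= T by exact: ltW.
have W1P u : CB T u -> Z T (w1 u) /\ mild T u (w1 u).
  move=> Bu; have [[z zP] _] := exist_sol T ltac:(by rewrite T_gt0 TT0) u Bu.
  exact: (@xgetPex _ (fun=> 0) [set z | Z T z /\ mild T u z] (ex_intro _ z zP)).
have lw0 : 0 < lw.
  by rewrite /lw !mulr_gt0 ?expR_gt0// ltr_wpDl.
have W1_lip u u' d : CB T u -> CB T u' -> 0 <= d ->
    (forall t, 0 <= t <= T -> H2norm a b (u t - u' t) <= d) ->
    forall t, 0 <= t <= T -> NX (w1 u t - w1 u' t) <= lw * d.
  move=> Bu Bu' d0 ud t tT.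
  have [Zz mz] := W1P _ Bu; have [Zz' mz'] := W1P _ Bu'.
  rewrite (le_trans (wave_solution_lipschitz ab bF0 bp0 kappa0 v02 w01 w0k CC rk SX M0E
    T0' Bu Bu' Zz mz Zz' mz' d0 ud tT))// /lw ler_wpM2r//.
  have M1 : 0 < `|M0| + 1 by rewrite ltr_wpDl.
  rewrite ler_pM ?expR_ge0//.
  - by rewrite !mulr_ge0// ?ltW.
  - by rewrite ler_pM2l// ler_pM2l ?mulr_gt0// ltW.
  - rewrite ler_expR ler_wpM2l ?(ltW TT0)//.
    by rewrite !mulr_ge0 ?invr_ge0 ?exprn_ge0// ltW.
split; [exact: W1P|move=> u u' Bu Bu'|move=> u Bu|move=> u u' Bu Bu'].
- apply: (sup_norm_le_mul T0' lw0) => [x|d d0 ud]; first exact: sqrtr_ge0.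
  exact: W1_lip.
- exact: (quotient_C0T ab kappa0 w01 w0k CC rk (W1P u Bu).1).
- have CabP : sobolev_constant a b (xget 0 (sobolev_constant a b)).
    exact: (@xgetPex _ 0 (sobolev_constant a b) (ex_intro _ C CC)).
  have [Cab0 _] := CabP.
  have w0n : 0 < H1norm a b w0.
    have := lt_le_trans kappa0 (le_sobolev_H1norm ab CC w01 w0k).
    by rewrite pmulr_rgt0.
  have K0 : 0 < 2 / kappa + 4 / kappa ^+ 2 *
             (xget 0 (sobolev_constant a b) * (L2norm a b v0 + H1norm a b w0)).
    rewrite addr_gt0 ?mulr_gt0 ?invr_gt0 ?exprn_gt0//.
    by rewrite ltr_wpDl// L2norm_ge0.
  have lw20 : 0 < lw2 by rewrite /lw2 mulr_gt0.
  apply: (sup_norm_le_mul T0' lw20) => [x|d d0 ud t tT]; first exact: sqrtr_ge0.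
  have [Zz _] := W1P _ Bu; have [Zz' _] := W1P _ Bu'.
  have := quotient_lipschitz ab kappa0 w01 w0k CC rk Zz Zz' tT tT CabP.
  move=> /le_trans; apply; rewrite /lw2 -[leRHS]mulrA ler_pM ?sqrtr_ge0//.
  + rewrite addr_ge0 ?mulr_ge0 ?invr_ge0 ?exprn_ge0 ?L2norm_ge0// ltW//.
  + rewrite lerD2l ler_pM2l ?divr_gt0 ?exprn_gt0// ler_pM2l//.
    have [z2 _] := Zspace_phase Zz' tT.
    have vr : L2norm a b ((w1 u' t).1 - v0) <= r.
      exact: (le_trans (L2norm_fst_le_phase a b (w1 u' t - z0)) (Zspace_near Zz' tT)).
    have := L2normD (L2B z2 v02) v02; rewrite subrK => /le_trans; apply.
    rewrite addrC lerD2l (le_trans vr)// (le_trans (ltW rk))//.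
    rewrite ler_pdivrMr ?mulr_gt0// (le_trans (le_sobolev_H1norm ab CC w01 w0k))//.
    rewrite mulrC mulrCA ler_peMl//; last by rewrite ler1n.
    by rewrite mulr_ge0// ltW.
  + exact: W1_lip.
Qed.
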